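(* Let $G$ be a discrete group, let $X$ be a locally compact Hausdorff space, and let $\sigma=((X_g)_{g\in G},(\sigma_g)_{g\in G})$ be a partial action of $G$ on $X$ with the decomposition property. Then: (1) There is a natural isomorphism $C_0(X)^G\cong C_0(X/G)$. (2) $\sigma$ is free if and only if the canonical corner embedding $c\colon C_0(X)^G\to C_0(X)\rtimes_\sigma G$ has full range.
   Context: Partial actions: a partial action $\alpha=((A_g)_{g\in G},(\alpha_g)_{g\in G})$ of a discrete group $G$ on a $C^*$-algebra $A$ consists of closed two-sided ideals $A_g$ of $A$ and $*$-isomorphisms $\alpha_g\colon A_{g^{-1}}\to A_g$ such that $A_1=A$, $\alpha_1=\mathrm{id}_A$, and $\alpha_{gh}$ extends $\alpha_g\circ\alpha_h$ wherever the composition is defined. A partial action $\sigma=((X_g)_{g\in G},(\sigma_g)_{g\in G})$ on a locally compact Hausdorff space $X$ is defined analogously, with open subsets $X_g$ and homeomorphisms $\sigma_g\colon X_{g^{-1}}\to X_g$; it induces a partial action on $A=C_0(X)$ with $A_g=C_0(X_g)$ and $\alpha_g(f)=f\circ\sigma_{g^{-1}}$. We write $C_0(X)\rtimes_\sigma G$ for the corresponding (full) partial crossed product. $X/G$ is the orbit space with the quotient topology, where $x\sim y$ iff $y=\sigma_g(x)$ for some $g$ with $x\in X_{g^{-1}}$. $\sigma$ is free if $\sigma_g(x)=x$ for some $x\in X_{g^{-1}}$ implies $g=1$. Crossed product: $A\rtimes_\alpha G$ is the enveloping $C^*$-algebra of the $*$-algebra of finite sums $\sum_g a_g\delta_g$,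 $a_g\in A_g$, with product $(a\delta_g)(b\delta_h)=\alpha_g(\alpha_{g^{-1}}(a)b)\delta_{gh}$ and involution $(a\delta_g)^*=\alpha_{g^{-1}}(a^* )\delta_{g^{-1}}$. Decomposition property: for $n\in\mathbb{N}=\{1,2,\ldots\}$ let $\mathcal{T}_n(G)=\{\tau\subseteq G\colon 1\in\tau,\ |\tau|=n\}$, and $A_\tau=\bigcap_{g\in\tau}A_g$. $\alpha$ has the $n$-decomposition property if (a) $A=\overline{\sum_{\tau\in\mathcal{T}_n(G)}A_\tau}$, and (b) $A_\tau\cap A_g=\{0\}$ for all $\tau\in\mathcal{T}_n(G)$ and $g\in G\setminus\tau$. It has the decomposition property if this holds for some $n$. A partial action on $X$ has the decomposition property if the induced one on $C_0(X)$ does. Fixed point algebra: $A^G$ is the $C^*$-algebra of all $a\in A$ with $\alpha_{g^{-1}}(ab)=a\,\alpha_{g^{-1}}(b)$ for all $g\in G$, $b\in A_g$. The canonical corner embedding $c$ of an action $\alpha$ with the $n$-decomposition property: $G$ acts partially on $\mathcal{T}_n(G)$ by $\tau\mapsto g\tau$ for $\tau\ni g^{-1}$; let $\mathcal{O}_n(G)$ be the orbit space and choose for each $z\in\mathcal{O}_n(G)$ a representative $\tau_z$ of the orbit $z$. For $\tau\in\mathcal{T}_n(G)$ let $H_\tau=\{h\in G\colon h\tau=\tau\}$ (a finite subgroup whose order divides $n$), $m_\tau=\frac{n}{|H_\tau|}-1$, and choose $x_0=1,x_1,\ldots,x_{m_\tau}\in G$ with $\tau=\bigsqcup_{j=0}^{m_\tau}H_\tau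 x_j$. The ideal $A_{G\cdot\tau}=\sum_{g\in\tau^{-1}}A_{g\tau}$ ($\tau^{-1}=\{g^{-1}\colon g\in\tau\}$) is $G$-invariant and is the direct sum of the ideals $A_{x_j^{-1}\tau}$, $0\le j\le m_\tau$; let $\pi_j\colon A_{G\cdot\tau}\to A_{x_j^{-1}\tau}$ be the projections. Define $c_\tau\colon A_{G\cdot\tau}^G\to A_{G\cdot\tau}\rtimes_\alpha G$ by $$c_\tau(a)=\frac{1}{|H_\tau|(m_\tau+1)}\sum_{j,k=0}^{m_\tau}\sum_{h\in H_\tau}\pi_j(a)\delta_{x_j^{-1}hx_k}.$$ Since $A$ is equivariantly the direct sum of the $A_{G\cdot\tau_z}$, $z\in\mathcal{O}_n(G)$, one sets $c=\bigoplus_{z}c_{\tau_z}\colon A^G\to A\rtimes_\alpha G$; it does not depend on the choices made. The image of $c$ is a corner ($pBp$ for a projection $p\in M(B)$) in $B=A\rtimes_\alpha G$; $c$ has full range if this corner is full, i.e. not contained in any proper closed two-sided ideal of $B$. *)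

(* Defs.v *)
From HB Require Import structures.
From mathcomp Require Import all_boot all_order all_algebra.
From mathcomp Require Import finmap generic_quotient.
From mathcomp Require Import all_classical all_reals all_analysis.
From mathcomp Require Import complex ring.
From mathcomp Require summability.

Set Implicit Arguments.
Unset Strict Implicit.
Unset Printing Implicit Defensive.

Import Order.TTheory GRing.Theory Num.Theory.
Import numFieldNormedType.Exports.
Local Open Scope classical_set_scope.
Local Open Scope ring_scope.
Local Open Scope quotient_scope.

Definition cplx (R : realType) : numClosedFieldType := R[i].

Section complex_numbers.
Variable R : realType.
Let C := cplx R.

Lemma cplx_ge0_real (z : C) : 0 <= z -> exists2 r : R, 0 <= r & z = (r%:C)%C :> R[i].
Proof.
move=> z0; have /complex_realP[k zk] : (z : R[i]) \is Num.real by exact: ger0_real.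
by exists k => //; rewrite -ler0c -zk.
Qed.

Lemma cplx_complete (F : set_system C) : ProperFilter F -> cauchy F -> cvg F.
Proof.
move=> FF /cauchyP Fc.
pose re : C -> R := @complex.Re R; pose im : C -> R := @complex.Im R.
have lec (e : R) (x y : C) : ball x ((e%:C)%C : C) y ->
    `|re x - re y| < e /\ `|im x - im y| < e.
  rewrite -ball_normE /ball_ /= => h.
  have hre : (`|re x - re y|%:C)%C <= `|x - y| :> C.
    by have := normc_ge_Re (x - y : R[i]); rewrite raddfB.
  have him : (`|im x - im y|%:C)%C <= `|x - y| :> C.
    rewrite -[leRHS]mul1r; have <- : `|'i%C : R[i]| = 1.
      by rewrite normc_def /= expr0n expr1n add0r sqrtr1.
    have := normc_ge_Re ('i%C * (x - y) : R[i]).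
    by rewrite normrM mulrC ReiNIm normrN raddfB.
  by split; rewrite -ltcR; [exact: le_lt_trans hre h|exact: le_lt_trans him h].
have cvgre : cvg (re @ F).
  apply: R_complete; apply/cauchyP => _/posnumP[e].
  have /Fc[x Fx] : 0 < ((e%:num)%:C)%C :> C by rewrite ltcR.
  exists (re x); rewrite /nbhs /=; apply: filterS Fx => y /lec[+ _].
  by rewrite -ball_normE.
have cvgim : cvg (im @ F).
  apply: R_complete; apply/cauchyP => _/posnumP[e].
  have /Fc[x Fx] : 0 < ((e%:num)%:C)%C :> C by rewrite ltcR.
  exists (im x); rewrite /nbhs /=; apply: filterS Fx => y /lec[_ +].
  by rewrite -ball_normE.
move: cvgre cvgim => /cvg_ex[/= a /cvgrPdist_lt Fa] /cvg_ex[/= b /cvgrPdist_lt Fb].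
apply: (@cvgP _ _ (Complex a b : C)); apply/(@cvgrPdist_lt C) => e e0.
have [r r0 er] := cplx_ge0_real (ltW e0); rewrite er in e0 *.
have {r0}r2 : 0 < r / 2 by rewrite divr_gt0// -ltcR.
near=> z; rewrite (splitr r) [ltRHS]raddfD/=.
set w : C := _ - z.
have -> : w = ((complex.Re (w : R[i]))%:C)%C + 'i%C * ((complex.Im (w : R[i]))%:C)%C :> R[i].
  exact: complexE.
apply: le_lt_trans (ler_normD _ _) _.
rewrite normrM; have -> : `|'i%C : R[i]| = 1.
  by rewrite normc_def /= expr0n expr1n add0r sqrtr1.
rewrite mul1r !normc_def /= !expr0n/= !addr0 !sqrtr_sqr.
apply: ltrD; rewrite ltcR.
- by rewrite /w raddfB/=; near: z; exact: Fa.
- by rewrite /w raddfB/=; near: z; exact: Fb.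
Unshelve. all: by end_near. Qed.

End complex_numbers.

(* C*-algebras need not be unital, so the product is not a ring structure of
   the library. *)
HB.mixin Record isCstarAlgebra (R : realType) A
    & CompleteNormedModule (cplx R) A := {
  cmul : A -> A -> A ;
  cstar : A -> A ;
  cmulA : associative cmul ;
  cmulDl : left_distributive cmul +%R ;
  cmulDr : right_distributive cmul +%R ;
  cmulZl : forall (k : cplx R) x y, cmul (k *: x) y = k *: cmul x y ;
  cmulZr : forall (k : cplx R) x y, cmul x (k *: y) = k *: cmul x y ;
  cstarD : forall x y, cstar (x + y) = cstar x + cstar y ;
  cstarZ : forall (k : cplx R) x, cstar (k *: x) = k^* *: cstar x ;
  cstarM : forall x y, cstar (cmul x y) = cmul (cstar y) (cstar x) ;
  cstarK : involutive cstar ;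
  cnormM : forall x y, `|cmul x y| <= `|x| * `|y| ;
  cnormCstar : forall x, `|cmul (cstar x) x| = `|x| ^+ 2
}.

#[short(type="cstarAlgType")]
HB.structure Definition CstarAlgebra (R : realType) :=
  {A of isCstarAlgebra R A & CompleteNormedModule (cplx R) A}.

Declare Scope cstar_scope.
Delimit Scope cstar_scope with cs.
Local Open Scope cstar_scope.
Notation "x ** y" := (cmul x y) (at level 40, left associativity) : cstar_scope.

Section C0_space.
Variables (R : realType) (X : topologicalType).
Let C := cplx R.

Definition vanishes_at_infinity (f : X -> C) :=
  forall e : C, 0 < e -> exists2 K : set X,
    compact K & forall x, ~ K x -> `|f x| < e.

Definition C0_pred : {pred X -> C} :=
  [pred f | `[< continuous f /\ vanishes_at_infinity f >] ].

Record C0 := MkC0 { C0_fun :> X -> C ; _ : C0_fun \in C0_pred }.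

HB.instance Definition _ := [isSub for C0_fun].
HB.instance Definition _ := [Choice of C0 by <:].

Lemma C0P (f : X -> C) :
  reflect (continuous f /\ vanishes_at_infinity f) (f \in C0_pred).
Proof. exact: asboolP. Qed.

Lemma C0_continuous (f : C0) : continuous (f : X -> C).
Proof. by case: f => f /= /C0P[]. Qed.

Lemma C0_vanishes (f : C0) : vanishes_at_infinity f.
Proof. by case: f => f /= /C0P[]. Qed.

Lemma C0_ext (f g : C0) : (forall x, f x = g x) -> f = g.
Proof. by move=> fg; apply/val_inj/funext. Qed.

Lemma C0_submod_closed : submod_closed C0_pred.
Proof.
split=> [|k f g /C0P[cf vf] /C0P[cg vg]]; apply/C0P.
  split; first exact: cst_continuous.
  by move=> e e0; exists set0; [exact: compact0|move=> x _; rewrite normr0].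
split; first by move=> x; apply: cvgD (cg x); apply: cvgM (cf x); exact: cvg_cst.
move=> e e0; have e2 : 0 < e / 2 by rewrite divr_gt0.
have ke : 0 < e / 2 / (`|k| + 1) by rewrite divr_gt0// ltr_wpDl.
have [K1 cK1 fK1] := vf _ ke; have [K2 cK2 gK2] := vg _ e2.
exists (K1 `|` K2); first exact: compactU.
move=> x /not_orP[/fK1 h1 /gK2 h2].
rewrite [e]splitr; apply: le_lt_trans (ler_normD _ _) _; rewrite ler_ltD//.
rewrite normrM; have k1 : 0 < `|k| + 1 by rewrite ltr_wpDl.
rewrite -(@divfK _ (`|k| + 1) _ (e / 2)) ?gt_eqF// mulrC.
by apply: ler_pM => //; [exact: ltW|rewrite lerDl].
Qed.

HB.instance Definition _ :=
  GRing.isSubmodClosed.Build C (X -> C) C0_pred C0_submod_closed.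
HB.instance Definition _ := [SubChoice_isSubLmodule of C0 by <:].

Lemma C0D (f g : C0) x : (f + g) x = f x + g x. Proof. by []. Qed.
Lemma C0B (f g : C0) x : (f - g) x = f x - g x. Proof. by []. Qed.
Lemma C0Z k (f : C0) x : (k *: f) x = k * f x. Proof. by []. Qed.
Lemma C00 x : (0 : C0) x = 0. Proof. by []. Qed.

Definition cabs (z : C) : R := complex.Re (`|z| : R[i]).

Lemma cabsE z : (cabs z)%:C%C = `|z| :> R[i].
Proof. by rewrite /cabs RRe_real// normr_real. Qed.

Lemma cabs_continuous : continuous cabs.
Proof.
move=> z; apply/(@cvgrPdist_lt R R C (nbhs z) _) => e e0.
have eC : 0 < (e%:C)%C :> C by rewrite ltcR.
have /(@cvgrPdist_lt C C _ (nbhs z) _)/(_ _ eC) := @norm_continuous _ C z.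
apply: (@filterS _ (nbhs z)) => w h; rewrite -ltcR; apply: le_lt_trans h.
have -> : `|z| - `|w| = ((cabs z - cabs w)%:C)%C :> R[i].
  by rewrite rmorphB/= !cabsE.
by rewrite normc_def /= expr0n/= addr0 sqrtr_sqr.
Qed.

Lemma C0_bounded (f : C0) : has_ubound (range (cabs \o f)).
Proof.
have [K cK fK] := C0_vanishes f ltr01.
have /compact_bounded : compact ((cabs \o f) @` K).
  apply: continuous_compact cK; apply: continuous_subspaceT => x.
  by apply: continuous_comp; [exact: C0_continuous|exact: cabs_continuous].
case=> M [_ /(_ (M + 1))]; rewrite ltrDl ltr01 => /(_ isT) h.
exists (Num.max (M + 1) 1) => _ [x _ <-] /=; rewrite le_max.
have [Kx|Kx] := pselect (K x).
  by rewrite (le_trans (ler_norm _))// h//; exists x.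
by rewrite orbC -lecR cabsE ltW// fK.
Qed.

Definition C0_norm (f : C0) : C := ((sup (range (cabs \o f)))%:C)%C.

Lemma C0_norm_ub (f : C0) x : `|f x| <= C0_norm f.
Proof.
by rewrite -[leLHS]cabsE lecR; apply: ub_le_sup; [exact: C0_bounded|exists x].
Qed.

Lemma C0_norm_ge0 (f : C0) : 0 <= C0_norm f.
Proof.
rewrite ler0c; have [[y [x _ _]]|] := pselect (range (cabs \o f) !=set0).
  have fx : range (cabs \o f) (cabs (f x)) by exists x.
  by apply: le_trans (ub_le_sup (C0_bounded f) fx); rewrite -ler0c cabsE.
by move/set0P/negP/negbNE/eqP => ->; rewrite sup0.
Qed.

Lemma C0_norm_le (f : C0) (e : C) :
  0 <= e -> (forall x, `|f x| <= e) -> C0_norm f <= e.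
Proof.
move=> e0 fe; have [r r0 er] := cplx_ge0_real e0; rewrite er /C0_norm lecR.
have [ne|] := pselect (range (cabs \o f) !=set0); last first.
  by move/set0P/negP/negbNE/eqP => ->; rewrite sup0.
by apply: ge_sup => // _ [x _ <-] /=; rewrite -lecR -er cabsE; exact: fe.
Qed.

Lemma C0_normD (f g : C0) : C0_norm (f + g) <= C0_norm f + C0_norm g.
Proof.
apply: C0_norm_le => [|x]; first by rewrite addr_ge0// C0_norm_ge0.
by rewrite (le_trans (ler_normD _ _))// lerD// C0_norm_ub.
Qed.

Lemma C0_normZ (k : C) (f : C0) : C0_norm (k *: f) = `|k| * C0_norm f.
Proof.
apply/eqP; rewrite eq_le; apply/andP; split.
  apply: C0_norm_le => [|x]; first by rewrite mulr_ge0// C0_norm_ge0.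
  by rewrite C0Z normrM ler_wpM2l// C0_norm_ub.
have [->|k0] := eqVneq k 0; first by rewrite normr0 mul0r C0_norm_ge0.
have nk : 0 < `|k| by rewrite normr_gt0.
rewrite mulrC -ler_pdivlMr//; apply: C0_norm_le => [|x].
  by rewrite divr_ge0// C0_norm_ge0.
by rewrite ler_pdivlMr// mulrC -normrM -C0Z C0_norm_ub.
Qed.

Lemma C0_norm_eq0 (f : C0) : C0_norm f = 0 -> f = 0.
Proof.
move=> f0; apply: C0_ext => x; apply/eqP; rewrite -normr_le0 -f0.
exact: C0_norm_ub.
Qed.

HB.instance Definition _ :=
  Lmodule_isNormed.Build C C0 C0_normD C0_normZ C0_norm_eq0.

Lemma C0_normE (f : C0) : `|f| = C0_norm f. Proof. by []. Qed.

Lemma C0_complete (F : set_system C0) : ProperFilter F -> cauchy F -> cvg F.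
Proof.
move=> FF /cauchyP Fc.
have near e : 0 < e :> C -> exists h : C0, \forall f \near F, `|h - f| < e.
  by move=> /Fc[h Fh]; exists h; apply: filterS Fh => f; rewrite -ball_normE.
have cvx x : cvg ((fun f : C0 => f x : C) @ F).
  apply: cplx_complete; apply/cauchyP => e /near[h Fh]; exists (h x).
  rewrite /nbhs /=; apply: filterS Fh => f hf; rewrite -ball_normE /ball_ /=.
  by apply: le_lt_trans hf; rewrite -C0B; exact: C0_norm_ub.
pose g x : C := lim ((fun f : C0 => f x : C) @ F).
have gE e : 0 < e :> C -> exists2 h : C0, (\forall f \near F, `|h - f| < e) &
    forall x, `|h x - g x| <= e.
  move=> e0; have [h Fh] := near _ e0; exists h => // x.
  apply/ler_addgt0Pr => d d0.
  have /(@cvgrPdist_lt C)/(_ _ d0) Fg := cvx x.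
  have [f [/= fg hf]] := filter_ex (filterI Fg Fh).
  rewrite -(subrKA (f x)) (le_trans (ler_normD _ _))// lerD//.
    by rewrite -C0B (le_trans (C0_norm_ub _ _))// ltW.
  by rewrite distrC ltW.
have gC0 : g \in C0_pred.
  apply/C0P; split=> [x|e e0].
    apply/(@cvgrPdist_lt C) => e e0; have e3 : 0 < e / 3 by rewrite divr_gt0.
    have [h _ hg] := gE _ e3.
    have /(@cvgrPdist_lt C)/(_ _ e3) := @C0_continuous h x.
    apply: filterS => y hxy; rewrite -(subrKA (h x)) -(subrKA (h y) (h x)).
    have -> : e = e / 3 + (e / 3 + e / 3) by field.
    apply: le_lt_trans (ler_normD _ _) _; apply: ler_ltD.
      by rewrite distrC.
    by apply: le_lt_trans (ler_normD _ _) _; apply: ltr_leD.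
  have e2 : 0 < e / 2 by rewrite divr_gt0.
  have [h _ hg] := gE _ e2; have [K cK hK] := C0_vanishes h e2.
  exists K => // x /hK hx; rewrite [e]splitr -[g x](subrK (h x)).
  by apply: le_lt_trans (ler_normD _ _) _; rewrite ler_ltD// distrC.
apply: (@cvgP _ _ (MkC0 gC0)); apply/cvgrPdist_le => e e0.
have e2 : 0 < e / 2 by rewrite divr_gt0.
have [h Fh hg] := gE _ e2; apply: filterS Fh => f hf.
apply: C0_norm_le => [|x]; first exact: ltW.
rewrite C0B /= -(subrKA (h x)) [e]splitr (le_trans (ler_normD _ _))// lerD//.
  by rewrite distrC.
by rewrite -C0B (le_trans (C0_norm_ub _ _))// ltW.
Qed.

HB.instance Definition _ := Uniform_isComplete.Build C0 C0_complete.

End C0_space.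

Section C0_cstar.
Variables (R : realType) (X : topologicalType).
Let C := cplx R.
Local Notation C0 := (C0 R X).

Lemma conj_continuous : continuous (fun z : C => z^* ).
Proof.
move=> z; apply/(@cvgrPdist_lt C C C (nbhs z) _) => e e0.
have /(@cvgrPdist_lt C C C (nbhs z) _)/(_ _ e0) : (fun w : C => w) @ z --> z.
  exact: cvg_id.
by apply: (@filterS _ (nbhs z)) => w; rewrite -rmorphB norm_conjC.
Qed.

Lemma C0_mul_subproof (f g : C0) : (fun x => f x * g x) \in @C0_pred R X.
Proof.
apply/C0P; split=> [x|e e0].
  by apply: cvgM; exact: C0_continuous.
have ke : 0 < e / (`|g| + 1) by rewrite divr_gt0// ltr_wpDl.
have [K cK fK] := C0_vanishes f ke; exists K => // x /fK fx.
have g1 : 0 < `|g| + 1 by rewrite ltr_wpDl.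
rewrite normrM -[ltRHS](@divfK _ (`|g| + 1)) ?gt_eqF//.
apply: le_lt_trans (_ : `|f x| * (`|g| + 1) < _); last by rewrite ltr_pM2r.
by rewrite ler_wpM2l// (le_trans (C0_norm_ub g x))// lerDl.
Qed.

Definition C0_mul (f g : C0) : C0 := MkC0 (C0_mul_subproof f g).

Lemma C0_star_subproof (f : C0) : (fun x => (f x)^* ) \in @C0_pred R X.
Proof.
apply/C0P; split=> [x|e e0].
  by apply: continuous_comp; [exact: C0_continuous|exact: conj_continuous].
have [K cK fK] := C0_vanishes f e0; exists K => // x /fK.
by rewrite norm_conjC.
Qed.

Definition C0_star (f : C0) : C0 := MkC0 (C0_star_subproof f).

Lemma C0_mulA : associative C0_mul.
Proof. by move=> f g h; apply: C0_ext => x /=; rewrite mulrA. Qed.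
Lemma C0_mulDl : left_distributive C0_mul +%R.
Proof. by move=> f g h; apply: C0_ext => x; exact: mulrDl. Qed.
Lemma C0_mulDr : right_distributive C0_mul +%R.
Proof. by move=> f g h; apply: C0_ext => x; exact: mulrDr. Qed.
Lemma C0_mulZl (k : C) f g : C0_mul (k *: f) g = k *: C0_mul f g.
Proof. by apply: C0_ext => x; rewrite -[RHS]/(k * (f x * g x)) mulrA. Qed.
Lemma C0_mulZr (k : C) f g : C0_mul f (k *: g) = k *: C0_mul f g.
Proof.
apply: C0_ext => x.
by rewrite -[LHS]/(f x * (k * g x)) -[RHS]/(k * (f x * g x)) mulrCA.
Qed.
Lemma C0_starD f g : C0_star (f + g) = C0_star f + C0_star g.
Proof.
apply: C0_ext => x.
by rewrite -[LHS]/((f x + g x)^* ) rmorphD.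
Qed.
Lemma C0_starZ (k : C) f : C0_star (k *: f) = k^* *: C0_star f.
Proof.
apply: C0_ext => x.
by rewrite -[LHS]/((k * f x)^* ) rmorphM.
Qed.
Lemma C0_starM f g : C0_star (C0_mul f g) = C0_mul (C0_star g) (C0_star f).
Proof. by apply: C0_ext => x /=; rewrite rmorphM mulrC. Qed.
Lemma C0_starK : involutive C0_star.
Proof. by move=> f; apply: C0_ext => x /=; rewrite conjCK. Qed.
Lemma C0_normM f g : `|C0_mul f g| <= `|f| * `|g|.
Proof.
apply: C0_norm_le => [|x /=]; first by rewrite mulr_ge0.
by rewrite normrM ler_pM//; exact: C0_norm_ub.
Qed.
Lemma C0_normCstar f : `|C0_mul (C0_star f) f| = `|f| ^+ 2.
Proof.
apply/eqP; rewrite eq_le; apply/andP; split.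
  apply: C0_norm_le => [|x /=]; first by rewrite exprn_ge0.
  by rewrite mulrC -normCK normrX normr_id lerXn2r ?nnegrE//; exact: C0_norm_ub.
set c := leRHS; have c0 : 0 <= c by exact: normr_ge0.
rewrite -[c]sqrtCK lerXn2r ?nnegrE// ?sqrtC_ge0//.
apply: C0_norm_le => [|x]; first by rewrite sqrtC_ge0.
rewrite -(@ler_pXn2r _ 2) ?nnegrE// ?sqrtC_ge0// sqrtCK.
apply: le_trans (C0_norm_ub (C0_mul (C0_star f) f) x).
by rewrite /= mulrC -normCK normrX normr_id.
Qed.

HB.instance Definition _ := isCstarAlgebra.Build R C0
  C0_mulA C0_mulDl C0_mulDr C0_mulZl C0_mulZr C0_starD C0_starZ C0_starM
  C0_starK C0_normM C0_normCstar.

Lemma C0_cmulE (f g : C0) x : (f ** g) x = f x * g x. Proof. by []. Qed.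
Lemma C0_cstarE (f : C0) x : (cstar f : C0) x = (f x)^* . Proof. by []. Qed.

End C0_cstar.

Section cstar_notions.
Variables (R : realType) (A B : cstarAlgType R).

Definition closed_ideal (I : set A) :=
  [/\ closed I, I 0, (forall x y, I x -> I y -> I (x + y)),
      (forall (k : cplx R) x, I x -> I (k *: x)) &
      (forall x y, I x -> I (y ** x) /\ I (x ** y))].

(* The set [S] is meant to be a *-subalgebra. *)
Definition star_hom_on (S : set A) (f : A -> B) :=
  [/\ (forall x y, S x -> S y -> f (x + y) = f x + f y),
      (forall (k : cplx R) x, S x -> f (k *: x) = k *: f x),
      (forall x y, S x -> S y -> f (x ** y) = f x ** f y) &
      (forall x, S x -> f (cstar x) = cstar (f x))].

Definition star_iso_on (S : set A) (T : set B) (f : A -> B) :=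
  star_hom_on S f /\ set_bij S T f.

(* The algebraic sum of the subspaces [V i], [i \in D]. *)
Definition subspace_sum (I : choiceType) (D : set I) (V : I -> set A) : set A :=
  [set a | exists F : {fset I}, exists d : I -> A,
    (forall i, i \in F -> D i /\ V i (d i)) /\ a = \sum_(i <- F) d i].

(* The [j]-th component of [a] in the (c_0-)direct sum of the closed ideals
   [V i], [i \in D]; for finite [D] the algebraic sum is already closed. *)
Definition component (I : choiceType) (D : set I) (V : I -> set A) (j : I)
    (a : A) : A :=
  xget 0 [set b | V j b /\ closure (subspace_sum (D `\ j) V) (a - b)].

End cstar_notions.

Record partial_action (R : realType) (G : groupType) (A : cstarAlgType R) :=
  PartialAction {
  pdom : G -> set A ;
  pact : G -> A -> A ;
  pdom_ideal : forall g, closed_ideal (pdom g) ;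
  pact_iso : forall g, star_iso_on (pdom g^-1%g) (pdom g) (pact g) ;
  pdom1 : pdom 1%g = setT ;
  pact1 : forall a, pact 1%g a = a ;
  pactM : forall g h a, pdom h^-1%g a -> pdom g^-1%g (pact h a) ->
    pdom (g * h)^-1%g a /\ pact (g * h)%g a = pact g (pact h a)
}.

Definition homeo_on (X Y : topologicalType) (U : set X) (V : set Y)
    (f : X -> Y) :=
  [/\ set_bij U V f, {within U, continuous f} &
      exists2 k : Y -> X, {within V, continuous k} & {in U, cancel f k}].

Record top_partial_action (G : groupType) (X : topologicalType) :=
  TopPartialAction {
  tdom : G -> set X ;
  tact : G -> X -> X ;
  tdom_open : forall g, open (tdom g) ;
  tact_homeo : forall g, homeo_on (tdom g^-1%g) (tdom g) (tact g) ;
  tdom1 : tdom 1%g = setT ;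
  tact1 : forall x, tact 1%g x = x ;
  tactM : forall g h x, tdom h^-1%g x -> tdom g^-1%g (tact h x) ->
    tdom (g * h)^-1%g x /\ tact (g * h)%g x = tact g (tact h x)
}.

Section top_partial_action_theory.
Variables (G : groupType) (X : topologicalType) (s : top_partial_action G X).

Definition free_action :=
  forall g x, tdom s g^-1%g x -> tact s g x = x -> g = 1%g.

Lemma tact_dom g x : tdom s g^-1%g x -> tdom s g (tact s g x).
Proof. by have [[+ _ _] _ _] := tact_homeo s g; apply. Qed.

Lemma tactK g x : tdom s g^-1%g x -> tact s g^-1%g (tact s g x) = x.
Proof.
move=> gx; have := @tactM _ _ s g^-1%g g x gx; rewrite invgK mulVg => h.
by have [_ <-] := h (tact_dom gx); rewrite tact1.
Qed.

Lemma tactVK g x : tdom s g x -> tact s g (tact s g^-1%g x) = x.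
Proof. by move=> gx; rewrite -{1}[g]invgK tactK ?invgK. Qed.

Lemma tactV_dom g x : tdom s g x -> tdom s g^-1%g (tact s g^-1%g x).
Proof. by move=> gx; apply: tact_dom; rewrite invgK. Qed.

Definition orbit_rel : rel X :=
  [rel x y | `[< exists2 g, tdom s g^-1%g x & y = tact s g x >] ].

Lemma orbit_equiv_rel : equiv_class_of orbit_rel.
Proof.
split=> [x|x y|y x z].
- by apply/asboolP; exists 1%g; rewrite ?invg1 ?tdom1// tact1.
- have h u v : orbit_rel u v -> orbit_rel v u.
    move=> /asboolP[g gu ->]; apply/asboolP; exists g^-1%g; last by rewrite tactK.
    by rewrite invgK; exact: tact_dom.
  by apply/idP/idP; exact: h.
- move=> /asboolP[g gx ->] /asboolP[h hy ->]; apply/asboolP.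
  by have [hx E] := tactM gx hy; exists (h * g)%g.
Qed.

Canonical orbit_equiv := EquivRelPack orbit_equiv_rel.

Definition orbit_space := quotient_topology {eq_quot orbit_equiv}.

Definition orbit_proj : X -> orbit_space := \pi_orbit_space%qT.

End top_partial_action_theory.

Section induced_action.
Variables (R : realType) (G : groupType) (X : topologicalType).
Hypothesis hX : hausdorff_space X.
Variable s : top_partial_action G X.
Let C := cplx R.

(* C_0(U), seen as an ideal of C_0(X) through extension by 0 *)
Definition C0_ideal (U : set X) : set (C0 R X) :=
  [set f | forall x, ~ U x -> f x = 0].

Definition C0_act_fun (g : G) (f : C0 R X) (x : X) : C :=
  if x \in tdom s g then f (tact s g^-1%g x) else 0.

(* f o s_{g^-1} on X_g, extended by 0; the default value 0 of insubd is only
   used for f outside C_0(X_{g^-1}) *)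
Definition C0_act (g : G) (f : C0 R X) : C0 R X := insubd 0 (C0_act_fun g f).

Lemma C0_ideal_closed_ideal (U : set X) : closed_ideal (C0_ideal U).
Proof.
split=> [f clf x Ux|//|f h fU hU x Ux|k f fU x Ux|f h fU].
- apply/eqP; rewrite -normr_le0; apply/ler_addgt0Pr => e e0; rewrite add0r.
  have : nbhs f [set h : C0 R X | `|f - h| < e].
    apply/nbhs_ballP; exists e => //= h; by rewrite -ball_normE.
  move=> /clf[h [/= hU /ltW fh]].
  by rewrite -[f x]subr0 -(hU x Ux) -C0B (le_trans (C0_norm_ub _ _)).
- by rewrite C0D fU// hU// addr0.
- by rewrite C0Z fU// mulr0.
- by split=> x Ux; rewrite C0_cmulE fU// ?mulr0 ?mul0r.
Qed.

Lemma C0_act_subproof g (f : C0 R X) :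
  C0_ideal (tdom s g^-1%g) f -> C0_act_fun g f \in @C0_pred R X.
Proof.
move=> fg; have [bij ct _] := tact_homeo s g.
have [_ ctV _] := tact_homeo s g^-1%g; rewrite invgK in ctV.
pose L e := [set x | e <= `|f x|].
have compL e : 0 < e -> compact (tact s g @` L e).
  move=> e0; have [K cK fK] := C0_vanishes f e0.
  have Lg : L e `<=` tdom s g^-1%g.
    move=> x; rewrite /L /= => ex; apply: contrapT => /fg fx0.
    by move: ex; rewrite fx0 normr0 (lt_geF e0).
  apply: continuous_compact; first exact: (continuous_subspaceW Lg ct).
  apply: subclosed_compact cK _; last first.
    by move=> x ex; apply: contrapT => /fK h; move: ex; rewrite /L /= (lt_geF h).
  have [r _ er] := cplx_ge0_real (ltW e0).
  have -> : L e = (@cabs R \o f) @^-1` [set y : R | r <= y].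
    by apply/funext => x; rewrite /L /preimage /= -lecR cabsE -er.
  apply: (preimage_closed _ (@closed_ge R r)) => x _.
  by apply: continuous_comp; [exact: C0_continuous|exact: cabs_continuous].
have small e x : 0 < e -> ~ (tact s g @` L e) x -> `|C0_act_fun g f x| < e.
  move=> e0 xL; rewrite /C0_act_fun; case: ifPn => [|_]; last by rewrite normr0.
  rewrite inE => gx.
  rewrite real_ltNge ?normr_real ?(gtr0_real e0)//; apply/negP => Le; apply: xL.
  by exists (tact s g^-1%g x); [exact: Le|rewrite tactVK].
apply/C0P; split=> [x|e e0]; last first.
  by exists (tact s g @` L e); [exact: compL|move=> x; exact: small].
have [gx|gx] := pselect (tdom s g x).
  have cx : {for x, continuous ((f : X -> C) \o tact s g^-1%g)}.
    apply: continuous_comp; last exact: C0_continuous.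
    by move: ctV; rewrite (continuous_open_subspace _ (tdom_open s g)); apply; rewrite inE.
  have E : {near x, (f : X -> C) \o tact s g^-1%g =1 C0_act_fun g f}.
    have := open_nbhs_nbhs (conj (tdom_open s g) gx).
    by apply: filterS => y gy; rewrite /C0_act_fun mem_set.
  rewrite /continuous_at -(nbhs_singleton E).
  by apply: cvg_trans cx; apply: near_eq_cvg.
have fx0 : C0_act_fun g f x = 0 by rewrite /C0_act_fun memNset.
apply/(@cvgrPdist_lt C C) => e e0; rewrite fx0.
have xL : ~ (tact s g @` L e) x.
  move=> [y Ly yx]; apply: gx; rewrite -yx; apply: tact_dom.
  by apply: contrapT => /fg fy; move: Ly; rewrite /L /= fy normr0 (lt_geF e0).
have := open_nbhs_nbhs (conj (closed_openC (compact_closed hX (compL _ e0))) xL).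
by apply: filterS => y yL; rewrite sub0r normrN; exact: small.
Qed.

Lemma C0_actE g (f : C0 R X) x : C0_ideal (tdom s g^-1%g) f ->
  C0_act g f x = C0_act_fun g f x.
Proof. by move=> /C0_act_subproof ?; rewrite /C0_act [C0_fun _]insubdK. Qed.

Lemma C0_act_ext g (f h : C0 R X) : C0_ideal (tdom s g^-1%g) f ->
  (forall x, C0_act_fun g f x = h x) -> C0_act g f = h.
Proof. by move=> fg fh; apply: C0_ext => x; rewrite C0_actE. Qed.

Lemma C0_act_in g (f : C0 R X) x : C0_ideal (tdom s g^-1%g) f ->
  tdom s g x -> C0_act g f x = f (tact s g^-1%g x).
Proof. by move=> fg gx; rewrite C0_actE// /C0_act_fun mem_set. Qed.

Lemma C0_act_out g (f : C0 R X) x : C0_ideal (tdom s g^-1%g) f ->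
  ~ tdom s g x -> C0_act g f x = 0.
Proof. by move=> fg gx; rewrite C0_actE// /C0_act_fun memNset. Qed.

Lemma C0_act_ideal g (f : C0 R X) : C0_ideal (tdom s g^-1%g) f ->
  C0_ideal (tdom s g) (C0_act g f).
Proof. by move=> fg x gx; rewrite C0_act_out. Qed.

Lemma C0_act1 f : C0_act 1%g f = f.
Proof.
have f1 : C0_ideal (tdom s 1^-1%g) f by move=> x; rewrite invg1 tdom1 => /(_ I).
by apply: C0_ext => x; rewrite C0_act_in ?tdom1// invg1 tact1.
Qed.

Lemma C0_actM g h (f : C0 R X) : C0_ideal (tdom s h^-1%g) f ->
  C0_ideal (tdom s g^-1%g) (C0_act h f) ->
  C0_ideal (tdom s (g * h)^-1%g) f /\
  C0_act (g * h)%g f = C0_act g (C0_act h f).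
Proof.
move=> fh gf.
have key x : f x <> 0 -> tdom s h^-1%g x /\ tdom s g^-1%g (tact s h x).
  move=> fx; have hx : tdom s h^-1%g x by apply: contrapT => /fh.
  split=> //; apply: contrapT => /gf; rewrite C0_act_in//; last exact: tact_dom.
  by rewrite tactK.
have fgh : C0_ideal (tdom s (g * h)^-1%g) f.
  move=> x ghx; apply: contrapT => /key[hx gx].
  by apply: ghx; have [] := tactM hx gx.
split; first exact: fgh.
apply: C0_ext => x.
have [[gx hx]|ngh] := pselect (tdom s g x /\ tdom s h (tact s g^-1%g x)).
  have := @tactM _ _ s h^-1%g g^-1%g x; rewrite !invgK => /(_ gx hx).
  rewrite -invgM invgK => -[ghx E].
  by rewrite (C0_act_in fgh ghx) (C0_act_in gf gx) (C0_act_in fh hx) E.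
transitivity (0 : C).
  have [ghx|] := pselect (tdom s (g * h)%g x); last by move=> ?; rewrite C0_act_out.
  rewrite C0_act_in//; apply: contrapT => /key[hy gy]; apply: ngh.
  have [_ E] := tactM hy gy; rewrite tactVK// in E.
  by rewrite E; split; [exact: tact_dom|rewrite tactK//; exact: tact_dom].
have [gx|gx] := pselect (tdom s g x); last by rewrite C0_act_out.
rewrite C0_act_in// C0_act_out// => hx; exact: ngh.
Qed.

Lemma C0_actK g f : C0_ideal (tdom s g^-1%g) f ->
  C0_act g^-1%g (C0_act g f) = f.
Proof.
move=> fg; have [|_ <-] := @C0_actM g^-1%g g f fg.
  by rewrite invgK; exact: C0_act_ideal.
by rewrite mulVg C0_act1.
Qed.

Lemma C0_act_iso g :
  star_iso_on (C0_ideal (tdom s g^-1%g)) (C0_ideal (tdom s g)) (C0_act g).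
Proof.
have [_ _ addI scI mulI] := C0_ideal_closed_ideal (tdom s g^-1%g).
split; split.
- move=> f h fg hg; apply: C0_act_ext => [|x]; first exact: addI.
  rewrite -[RHS]/(C0_act g f x + C0_act g h x) (C0_actE x fg) (C0_actE x hg).
  by rewrite /C0_act_fun; case: ifP => _; rewrite ?addr0.
- move=> k f fg; apply: C0_act_ext => [|x]; first exact: scI.
  rewrite -[RHS]/(k * C0_act g f x) (C0_actE x fg).
  by rewrite /C0_act_fun; case: ifP => _; rewrite ?mulr0.
- move=> f h fg hg; apply: C0_act_ext => [|x]; first by have [] := mulI f h fg.
  rewrite -[RHS]/(C0_act g f x * C0_act g h x) (C0_actE x fg) (C0_actE x hg).
  by rewrite /C0_act_fun; case: ifP => _; rewrite ?mulr0.
- move=> f fg; apply: C0_act_ext => [y gy|x].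
    by rewrite C0_cstarE fg// rmorph0.
  rewrite -[RHS]/((C0_act g f x)^* ) (C0_actE x fg).
  by rewrite /C0_act_fun; case: ifP => _; rewrite ?rmorph0.
- by move=> f /C0_act_ideal.
- move=> f h /set_mem fg /set_mem hg E.
  by rewrite -(C0_actK fg) E C0_actK.
- move=> f fg; have fg' : C0_ideal (tdom s g^-1^-1%g) f by rewrite invgK.
  exists (C0_act g^-1%g f); first exact: C0_act_ideal.
  by have := C0_actK fg'; rewrite invgK.
Qed.

Lemma C0_ideal1 : C0_ideal (tdom s 1%g) = setT.
Proof. by rewrite tdom1 -subTset => f _ x /(_ I). Qed.

Definition C0_partial_action : partial_action G (C0 R X) :=
  @PartialAction R G (C0 R X) (fun g => C0_ideal (tdom s g)) C0_act
    (fun g => C0_ideal_closed_ideal (tdom s g)) C0_act_iso C0_ideal1 C0_act1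
    C0_actM.

End induced_action.

Section crossed_product.
Variables (R : realType) (G : groupType) (A : cstarAlgType R).
Variable alpha : partial_action G A.

(* A finite sum \sum_g a_g delta_g is encoded by its coefficients g |-> a_g. *)
Definition finite_sums : set (G -> A) :=
  [set x | finite_set [set g | x g != 0] /\ forall g, pdom alpha g (x g)].

Definition monomial (a : A) (g : G) : G -> A := fun k => if k == g then a else 0.

Definition fs_mul (x y : G -> A) : G -> A := fun k =>
  \sum_(g \in [set: G])
    pact alpha g (pact alpha g^-1%g (x g) ** y (g^-1 * k)%g).

Definition fs_star (x : G -> A) : G -> A := fun k =>
  pact alpha k (cstar (x k^-1%g)).

Lemma pdom0 g : pdom alpha g 0.
Proof. by have [] := pdom_ideal alpha g. Qed.

Lemma pact0 g : pact alpha g 0 = 0.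
Proof.
have [[_ sc _ _] _] := pact_iso alpha g.
by have := sc 0 0 (pdom0 _); rewrite !scale0r.
Qed.

Lemma cmul0r (a : A) : 0 ** a = 0.
Proof. by have := @cmulZl R A 0 0 a; rewrite !scale0r. Qed.

Lemma cmulr0 (a : A) : a ** 0 = 0.
Proof. by have := @cmulZr R A 0 a 0; rewrite !scale0r. Qed.

Lemma cstar0 : cstar (0 : A) = 0.
Proof. by have := @cstarZ R A 0 0; rewrite rmorph0 !scale0r. Qed.

Lemma fs_mul_monomial a b g h :
  fs_mul (monomial a g) (monomial b h) =
  monomial (pact alpha g (pact alpha g^-1%g a ** b)) (g * h)%g.
Proof.
apply/funext => k; rewrite /fs_mul.
rewrite -(@fsbig_widen _ _ _ _ [set g]) => [||l [_ /eqP/negbTE lg]]//; last first.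
  by rewrite /preimage /= /monomial lg pact0 cmul0r pact0.
rewrite fsbig_set1 /monomial eqxx.
have -> : (g^-1 * k == h)%g = (k == (g * h)%g).
  by apply/eqP/eqP => [<-|->]; rewrite ?mulKg ?mulVKg.
by case: eqP => // _; rewrite cmulr0 pact0.
Qed.

Lemma fs_star_monomial a g :
  fs_star (monomial a g) = monomial (pact alpha g^-1%g (cstar a)) g^-1%g.
Proof.
apply/funext => k; rewrite /fs_star /monomial -eqg_inv invgK.
by case: eqP => [->|_]//; rewrite cstar0 pact0.
Qed.

Definition cstar_seminorm (p : (G -> A) -> cplx R) :=
  forall x y, finite_sums x -> finite_sums y ->
  [/\ 0 <= p x, p (x + y) <= p x + p y,
      (forall k : cplx R, p (k *: x) = `|k| * p x),
      p (fs_mul x y) <= p x * p y &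
      p (fs_mul (fs_star x) x) = p x ^+ 2].

(* The enveloping C*-algebra of the *-algebra of finite sums: its completion
   for the largest C*-seminorm. *)
Record crossed_product := CrossedProduct {
  cp_alg :> cstarAlgType R ;
  cp_emb : (G -> A) -> cp_alg ;
  cp_embD : forall x y, finite_sums x -> finite_sums y ->
    cp_emb (x + y) = cp_emb x + cp_emb y ;
  cp_embZ : forall (k : cplx R) x, finite_sums x ->
    cp_emb (k *: x) = k *: cp_emb x ;
  cp_embM : forall x y, finite_sums x -> finite_sums y ->
    cp_emb (fs_mul x y) = cp_emb x ** cp_emb y ;
  cp_emb_star : forall x, finite_sums x ->
    cp_emb (fs_star x) = cstar (cp_emb x) ;
  cp_emb_dense : closure (cp_emb @` finite_sums) = setT ;
  cp_emb_max : forall p, cstar_seminorm p ->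
    forall x, finite_sums x -> p x <= `|cp_emb x|
}.

End crossed_product.

Section subsets_of_group.
Variable G : groupType.
Implicit Types (tau : {fset G}) (z : set {fset G}).

Definition Tn (n : nat) : set {fset G} :=
  [set tau : {fset G} | 1%g \in tau /\ #|` tau| = n].

Definition ltrans (g : G) tau : {fset G} := [fset (g * t)%g | t in tau]%fset.

(* g acts on tau when g^-1 \in tau, so this is the orbit of tau. *)
Definition Torbit tau : set {fset G} :=
  [set ltrans g tau | g in [set g | g^-1%g \in tau]].

Definition Torbits (n : nat) : set (set {fset G}) := Torbit @` Tn n.

(* If 1 \in tau, then every h with h tau = tau lies in tau. *)
Definition stab tau : {fset G} := [fset h in tau | ltrans h tau == tau]%fset.

Lemma stabP tau h : 1%g \in tau -> (h \in stab tau) = (ltrans h tau == tau).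
Proof.
move=> tau1; rewrite !inE /=; case: eqP => [E|_]; rewrite ?andbF ?andbT//.
by rewrite -E -[X in X \in _]mulg1; apply/imfsetP; exists 1%g.
Qed.

(* n / |H_tau| = m_tau + 1 when tau \in T_n(G) *)
Definition stab_index tau : nat := #|` tau| %/ #|` stab tau|.

(* x_0 = 1, ..., x_{m_tau} represent the cosets H_tau x_j which partition tau *)
Definition coset_reps tau (x : nat -> G) :=
  [/\ x 0%N = 1%g,
      [set` tau] = \bigcup_(j in `I_(stab_index tau))
                     [set (h * x j)%g | h in [set` stab tau]] &
      trivIset `I_(stab_index tau)
        (fun j => [set (h * x j)%g | h in [set` stab tau]])].

End subsets_of_group.

Section corner_embedding.
Variables (R : realType) (G : groupType) (A : cstarAlgType R).
Variable alpha : partial_action G A.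

(* A_tau *)
Definition pdomI (tau : {fset G}) : set A := \bigcap_(g in [set` tau]) pdom alpha g.

Definition decomposition_property (n : nat) :=
  [/\ (0 < n)%N,
      closure (subspace_sum (@Tn G n) pdomI) = setT &
      forall tau g, Tn n tau -> g \notin tau ->
        pdomI tau `&` pdom alpha g = [set 0]].

Definition fixed_algebra : set A :=
  [set a | forall g b, pdom alpha g b ->
    pact alpha g^-1%g (a ** b) = a ** pact alpha g^-1%g b].

(* A_{G tau} = \sum_{g \in tau^{-1}} A_{g tau} *)
Definition orbit_ideal (tau : {fset G}) : set A :=
  subspace_sum [set g | g^-1%g \in tau] (fun g => pdomI (ltrans g tau)).

Definition corner_tau (tau : {fset G}) (x : nat -> G) (a : A) : G -> A :=
  let m1 := stab_index tau in
  let p j := component `I_m1 (fun i => pdomI (ltrans (x i)^-1%g tau)) j a in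
  (#|` stab tau| * m1)%:R^-1 *:
    \sum_(j < m1) \sum_(k < m1) \sum_(h <- stab tau)
      monomial (p j) ((x j)^-1 * h * x k)%g.

(* [t z] is the representative tau_z, [x tau j] the coset representative x_j. *)
Definition corner_choices (n : nat) (t : set {fset G} -> {fset G})
    (x : {fset G} -> nat -> G) :=
  (forall z, Torbits n z -> z (t z)) /\
  (forall tau, Tn n tau -> coset_reps tau (x tau)).

(* c is the direct sum of the c_{tau_z} on the c_0-direct sum of the A_{G tau_z},
   i.e. an unconditional (possibly infinite) norm-convergent sum over the orbits;
   only its values on the fixed point algebra matter. *)
Definition corner_embedding (B : crossed_product alpha) (n : nat)
    (t : set {fset G} -> {fset G}) (x : {fset G} -> nat -> G) (a : A) : B :=
  summability.sum (fun z : set {fset G} =>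
    if z \in Torbits n then
      cp_emb B (corner_tau (t z) (x (t z))
        (component (Torbits n) (fun w => orbit_ideal (t w)) z a))
    else 0).

(* The corner is the image of the fixed point algebra under c. *)
Definition full_range (B : crossed_product alpha) (c : A -> B) :=
  forall I : set B, closed_ideal I -> c @` fixed_algebra `<=` I -> I = setT.

End corner_embedding.

(* Main.v *)
Require Import Defs.
From HB Require Import structures.
From mathcomp Require Import all_boot all_order all_algebra.
From mathcomp Require Import finmap generic_quotient.
From mathcomp Require Import all_classical all_reals all_analysis.
From mathcomp Require Import complex ring.

Set Implicit Arguments.
Unset Strict Implicit.
Unset Printing Implicit Defensive.

Import Order.TTheory GRing.Theory Num.Theory.
Import numFieldNormedType.Exports.
Local Open Scope classical_set_scope.
Local Open Scope ring_scope.
Local Open Scope cstar_scope.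

(** Let D x be the set of all g with x in X_g. Looking at bump functions, the
    decomposition property says that every D x has exactly n elements
    ([decomposition_finite_domains]). Since each X_g is open, D can only grow
    near a point, so having constant cardinality it is locally constant; and
    D (s_k x) = k D x. These two facts drive the whole proof: every condition
    on D x defines a clopen set, and the orbit of x is the finite set of the
    points s_{g^-1} x with g in D x.

    The orbit space. The projection is open, orbits are finite and
    they move continuously near a point, so the orbit space is Hausdorff and
    locally compact and the projection is proper. The fixed point algebra
    consists of the functions which are constant on orbits
    ([fixed_algebraP]); by properness those are exactly the functions
    obtained by composing the projection with an element of C_0(X/G)
    ([descend_iso]).

    The corner. In terms of D, the definition of c by cosets of stabilizers
    collapses to the formula
      c(a) = 1/n sum_g (a restricted to X_g) delta_g
    ([corner_tauE], [corner_partial_sumE]); the sum over the orbits converges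
    because averages do not increase the norm ([norm_cp_emb_avg]), which in
    turn follows from the contractivity of star homomorphisms out of C_0
    ([star_hom_contractive]).

    Free implies full. Let x lie in X_g. Compress c(a) by a bump function e
    near x on the left and a bump function e' near s_{g^-1} x on the right.
    Freeness makes the points s_{l^-1} x, l in D x, distinct, so for small
    supports only the term of c(a) at g survives. Hence a closed ideal I
    containing the range of c contains some f delta_g with f x nonzero. The
    f in C_0(X_g) with f delta_g in I form a closed ideal of C_0(X), and a
    closed ideal of C_0(X) contains every function vanishing on its common
    zeros ([closed_ideal_C0P]). So I contains all finite sums.

    Full implies free. Suppose that s_g x = x with g <> 1. Finite sums act on
    the l^2 space of the finite set D x ([orbit_rep]); as the operator norm
    is a C*-seminorm, the crossed product norm dominates the matrix
    coefficients of this action. Left translation by g permutes D x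
    and commutes with the representation, so the finite sums whose matrix
    absorbs this permutation form an ideal. Matrices of elements c(a) have all
    entries equal, so the closure of this ideal contains the range of c. It is
    proper, because on that ideal the coefficients at delta_1 and delta_g
    agree at x, while for a bump function f at x those of f delta_1 differ by
    1 ([isotropy_ideal_proper]). *)

(** * Functions vanishing at infinity *)

Lemma sqr_le_mul_cancel (F : numFieldType) (b c : F) :
  0 <= b -> 0 <= c -> c ^+ 2 <= b * c -> c <= b.
Proof.
move=> b0 c0; have [->//|cN] := eqVneq c 0.
by rewrite expr2 ler_pM2r// lt_def cN.
Qed.

(** Extends the finite subcover property to topological spaces without a base
    point: a nonempty compact set provides one. *)
Lemma compact_cover_compact (T : topologicalType) (A : set T) :
  compact A -> cover_compact A.
Proof.
move=> cA; have [[x Ax]|A0] := pselect (A !=set0); last first.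
  move=> I D f _ _; exists fset0 => // y Ay; exfalso; apply: A0; exists y; exact: Ay.
pose pT : ptopologicalType := HB.pack (T : Type) (Topological.class T) (isPointed.Build T x).
have : @compact pT A by exact: cA.
by rewrite (@compact_cover pT).
Qed.

Section C0_functions.
Variables (R : realType) (X : topologicalType).
Let C := cplx R.
Implicit Types (f : C0 R X).

Lemma real_complex_continuous : continuous (fun r : R => (r%:C)%C : C).
Proof.
move=> r; apply/(@cvgrPdist_lt C C R (nbhs r) _) => e e0.
have [d d0 ed] := cplx_ge0_real (ltW e0); rewrite ed ltcR in e0.
have /(@cvgrPdist_lt R R R (nbhs r) _)/(_ _ e0) : (fun w : R => w) @ r --> r.
  exact: cvg_id.
apply: (@filterS _ (nbhs r)) => w h; rewrite ed -rmorphB normc_def/= expr0n/= addr0.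
by rewrite sqrtr_sqr ltcR.
Qed.

Lemma C0_dominated (h : X -> C) f (M : C) : continuous h ->
  (forall x, `|h x| <= M * `|f x|) -> h \in @C0_pred R X.
Proof.
move=> ch hf; apply/C0P; split=> // e e0.
have M1 : 0 < `|M| + 1 by rewrite ltr_wpDl.
have [|K cK fK] := @C0_vanishes _ _ f (e / (`|M| + 1)); first by rewrite divr_gt0.
exists K => // x /fK; rewrite ltr_pdivlMr// => fx.
apply: le_lt_trans fx; apply: (le_trans (hf x)).
apply: (@le_trans _ _ (`|M| * `|f x|)).
  have h0 : 0 <= M * `|f x| by apply: le_trans (hf x).
  by rewrite -[leLHS]ger0_norm// normrM normr_id.
by rewrite mulrC ler_wpM2l// lerDl.
Qed.

Lemma C0_level_compact f (e : C) : 0 < e -> compact [set x | e <= `|f x|].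
Proof.
move=> e0; have [K cK fK] := C0_vanishes f e0.
apply: subclosed_compact cK _; last first.
  by move=> x ex; apply: contrapT => /fK h; move: ex; rewrite /= (lt_geF h).
have [r _ er] := cplx_ge0_real (ltW e0).
have -> : [set x | e <= `|f x|] = (@cabs R \o f) @^-1` [set y : R | r <= y].
  by apply/funext => x; rewrite /preimage /= -lecR cabsE -er.
apply: (preimage_closed _ (@closed_ge R r)) => x _.
by apply: continuous_comp; [exact: C0_continuous|exact: cabs_continuous].
Qed.

(** A locally compact Hausdorff space is completely regular. Separating x from
    the complement of the interior of a compact neighborhood makes the
    separating function vanish off a compact set, hence vanish at infinity. *)
Lemma C0_bump (hX : hausdorff_space X) (lcX : locally_compact [set: X])
    (U : set X) x : nbhs x U -> exists2 f : C0 R X, f x = 1 & C0_ideal U f.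
Proof.
wlog oU : U / open U.
  move=> H; rewrite nbhsE => -[V [oV Vx] VU].
  have [|f fx fV] := H V oV; first exact: open_nbhs_nbhs.
  by exists f => // y Uy; apply: fV => /VU.
move=> /nbhs_singleton Ux.
have [K Kx [cK clK]] : exists2 K, nbhs x K & compact K /\ closed K.
  have [K Kx cK] := lcX x I; exists K => //.
  by move: Kx; rewrite withinET.
have oW : open (U `&` K°) by apply: openI => //; exact: open_interior.
have cr := @locally_compact_completely_regular _ R lcX hX.
have /(cr x) : closed (~` (U `&` K°)) by exact: open_closedC.
case=> [|]; first by move=> [].
move=> uT [E H]; have /(@uniform_separatorP _ R)[h [ch _ h0 h1]] :
  uniform_separator [set x] (~` (U `&` K°)) by exists uT, E.
pose g y : C := ((1 - h y)%:C)%C.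
have gW y : ~ (U `&` K°) y -> g y = 0.
  by move=> Wy; rewrite /g (h1 (h y)) ?subrr//; exists y.
have gC0 : g \in @C0_pred R X.
  apply/C0P; split=> [y|e e0].
    apply: (@continuous_comp _ _ _ (fun y => 1 - h y)); last exact: real_complex_continuous.
    by apply: cvgB; [exact: cvg_cst|exact: ch].
  exists K => // y Ky; rewrite gW ?normr0// => -[_ /interior_subset]; exact: Ky.
exists (MkC0 gC0); first by rewrite /= /g (h0 (h x)) ?subr0//; exists x.
by move=> y Uy; apply: gW => -[].
Qed.

(** Truncating f by an open set U keeps it continuous as soon as U is also
    closed relative to the set where f is nonzero: at a zero of f, the
    truncation is squeezed by f. *)
Lemma C0_cut_subproof f (U : set X) : open U ->
  (forall x, ~ U x -> f x != 0 -> \forall y \near x, ~ U y) ->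
  (fun x => if x \in U then f x else 0) \in @C0_pred R X.
Proof.
move=> oU hU; apply: (@C0_dominated _ f 1) => [x|x]; last first.
  by rewrite mul1r; case: ifP => // _; rewrite normr0.
have cf := @C0_continuous _ _ f x.
have [Ux|Ux] := pselect (U x).
  have E : {near x, (f : X -> C) =1 (fun x => if x \in U then f x else 0)}.
    by have := open_nbhs_nbhs (conj oU Ux); apply: filterS => y Uy; rewrite mem_set.
  rewrite /continuous_at -(nbhs_singleton E).
  by apply: cvg_trans cf; apply: near_eq_cvg.
rewrite /continuous_at (memNset Ux); have [fx|fx] := eqVneq (f x) 0.
  apply/(@cvgrPdist_lt C C) => e e0.
  have /(@cvgrPdist_lt C C _ (nbhs x))/(_ _ e0) := cf.
  apply: filterS => y; rewrite fx !sub0r !normrN; case: ifP => // _ _.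
  by rewrite normr0.
have E : {near x, (fun=> 0 : C) =1 (fun x => if x \in U then f x else 0)}.
  by apply: filterS (hU _ Ux fx) => y Uy; rewrite memNset.
have c0 : (fun=> 0 : C) @ x --> (0 : C) by exact: cvg_cst.
by apply: cvg_trans c0; apply: near_eq_cvg.
Qed.

Definition C0_cut (U : set X) f : C0 R X :=
  locked (insubd 0 (fun x => if x \in U then f x else 0)).

Lemma C0_cutE f (U : set X) x : open U ->
  (forall x, ~ U x -> f x != 0 -> \forall y \near x, ~ U y) ->
  C0_cut U f x = if x \in U then f x else 0.
Proof. by move=> oU /(C0_cut_subproof oU) ?; rewrite /C0_cut -lock [C0_fun _]insubdK. Qed.

Lemma C0_sum (I : Type) (r : seq I) (P : pred I) (F : I -> C0 R X) x :
  (\sum_(i <- r | P i) F i) x = \sum_(i <- r | P i) F i x.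
Proof. by elim/big_rec2 : _ => // i f1 f2 _ <-. Qed.

Lemma closure_normP (V : normedModType C) (S : set V) b :
  closure S b <-> forall e : C, 0 < e -> exists2 a, S a & `|b - a| < e.
Proof.
split=> [cl e e0|h A /nbhs_ballP[e /= e0 eA]].
  have : nbhs b [set h : V | `|b - h| < e].
    by apply/nbhs_ballP; exists e => //= h; rewrite -ball_normE.
  by move=> /cl[h [Sh hb]]; exists h.
by have [a Sa ba] := h _ e0; exists a; split=> //; apply: eA; rewrite -ball_normE.
Qed.

(** Closed ideals of C_0(X) are determined by their common zeros. Given e, the
    compact set where |f| is at least e/2 is covered by finitely many sets on
    which some positive element of J exceeds 1; their sum j lies in J, and
    j (f / (j + t)) approximates f when t is small. *)
Lemma closed_ideal_C0P (J : set (C0 R X)) f : closed_ideal J ->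
  (forall x, f x != 0 -> exists2 j, J j & j x != 0) -> J f.
Proof.
move=> [clJ J0 JD JZ JM] fJ; apply: clJ; apply/closure_normP => e e0.
have e2 : 0 < e / 2 by rewrite divr_gt0.
pose L := [set x | e / 2 <= `|f x|].
have cL : compact L by exact: C0_level_compact.
(* positive elements of J exceeding 1 near a given point of L *)
pose P (j : C0 R X) := J j /\ forall y, 0 <= j y.
have loc x : L x -> exists2 j, P j & 1 < j x.
  rewrite /L /= => Lx; have fx0 : f x != 0.
    by rewrite -normr_gt0; apply: lt_le_trans Lx.
  have [j Jj jx] := fJ x fx0.
  have k0 : 0 < 2 / `|j x| ^+ 2 by rewrite divr_gt0// exprn_gt0 ?normr_gt0.
  exists (2 / `|j x| ^+ 2 *: (cstar j ** j)); last first.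
    rewrite C0Z C0_cmulE C0_cstarE mulrC.
    by rewrite [_^* * _]mulrC -normCK mulrCA mulfV ?mulr1 ?ltr1n// expf_neq0 ?normr_eq0.
  split=> [|y]; first by apply: JZ; have [] := JM _ (cstar j) Jj.
  by rewrite C0Z C0_cmulE C0_cstarE mulr_ge0 ?(ltW k0)// mulrC -normCK exprn_ge0.
pose D := [set j | P j].
have gtE (j : C0 R X) : P j -> [set y | 1 < j y] = (@cabs R \o j) @^-1` [set y : R | 1 < y].
  move=> [_ j0]; apply/funext => y; rewrite /preimage /= -ltcR cabsE.
  by rewrite ger0_norm.
have [|x /loc[j Pj jx]|F FD LF] := compact_cover_compact cL (D := D)
  (f := fun j => [set y | 1 < j y]).
- move=> j /gtE ->; apply: open_comp; last exact: open_gt.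
  by move=> x _; apply: continuous_comp; [exact: C0_continuous|exact: cabs_continuous].
- by exists j.
pose j := \sum_(i <- F) i.
have [Jj j0] : P j.
  rewrite /j big_seq; elim/big_ind : _ => [|a b [Ja a0] [Jb b0]|i /FD/set_mem//].
    by split.
  by split=> [|y]; [exact: JD|rewrite C0D addr_ge0].
have j1 x : L x -> 1 <= j x.
  move=> /LF[i /= Fi ix]; rewrite /j C0_sum (big_rem i)//= ler_wpDr ?(ltW ix)//.
  rewrite big_seq_cond sumr_ge0// => k; rewrite andbT => /mem_rem /FD/set_mem[_]; exact.
(* chosen such that |f| t <= e / 2, which controls the error f t / (j + t)
   where j >= 1 *)
pose t : C := e / 2 / (`|f| + 1).
have f1 : 0 < `|f| + 1 by rewrite ltr_wpDl.
have t0 : 0 < t by rewrite divr_gt0.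
have jt x : 0 < j x + t by rewrite ltr_wpDl.
have hC0 : (fun x => f x / (j x + t)) \in @C0_pred R X.
  apply: (@C0_dominated _ f t^-1) => x.
    apply: cvgM; first exact: C0_continuous.
    apply: cvgV; first by rewrite gt_eqF.
    by apply: cvgD; [exact: C0_continuous|exact: cvg_cst].
  rewrite normrM mulrC ler_wpM2r// normfV lef_pV2 ?posrE//.
    by rewrite gtr0_norm// lerDr.
  by rewrite normr_gt0 gt_eqF.
exists (j ** MkC0 hC0); first by have [] := JM _ (MkC0 hC0) Jj.
apply: (@le_lt_trans _ _ (e / 2)); last by rewrite gtr_pMr// invf_lt1 ?ltr1n.
apply: C0_norm_le => [|x]; first exact: ltW.
rewrite C0B C0_cmulE /=.
have -> : f x - j x * (f x / (j x + t)) = f x * (t / (j x + t)).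
  by field; rewrite gt_eqF.
rewrite normrM [X in _ * X]ger0_norm; last by rewrite divr_ge0 ?ltW.
have [Lx|Lx] := pselect (L x).
  apply: (@le_trans _ _ ((`|f| + 1) * t)); last by rewrite mulrC divfK ?gt_eqF.
  apply: ler_pM => //; first by rewrite divr_ge0 ?ltW.
    by rewrite (le_trans (C0_norm_ub _ _))// lerDl.
  by rewrite ler_pdivrMr// ler_peMr ?(ltW t0)// (le_trans (j1 x Lx))// lerDl ltW.
have {}Lx : `|f x| <= e / 2.
  have : e / 2 \is Num.real by exact: gtr0_real.
  by move=> /real_leVge -/(_ _ (normr_real (f x)))/orP[].
apply: le_trans Lx; rewrite ler_piMr// ler_pdivrMr// mul1r lerDr; exact: j0.
Qed.

End C0_functions.

Lemma norm_cstar (R : realType) (B : cstarAlgType R) (b : B) : `|cstar b| = `|b|.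
Proof.
have le (c : B) : `|c| <= `|cstar c|.
  have [->|c0] := eqVneq c 0; first by rewrite normr0.
  rewrite -(@ler_pM2r _ `|c|) ?normr_gt0// -expr2 -cnormCstar.
  exact: cnormM.
by apply/eqP; rewrite eq_le le/= -{2}[b]cstarK le.
Qed.

(** * Ideals and star homomorphisms of C*-algebras *)

Section closures_of_ideals.
Variables (R : realType) (B : cstarAlgType R).
Implicit Types (S K I : set B) (a b c : B).

Lemma cmulBl a b c : (a - b) ** c = a ** c - b ** c.
Proof. by rewrite cmulDl -scaleN1r cmulZl scaleN1r. Qed.

Lemma cmulBr a b c : c ** (a - b) = c ** a - c ** b.
Proof. by rewrite cmulDr -scaleN1r cmulZr scaleN1r. Qed.

Lemma mul_closure S I a b : closed I ->
  (forall y, S y -> I (y ** b) /\ I (b ** y)) -> closure S a ->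
  I (a ** b) /\ I (b ** a).
Proof.
move=> clI SI /closure_normP Sa; have b1 : 0 < `|b| + 1 by rewrite ltr_wpDl.
suff near (e : cplx R) : 0 < e ->
    exists2 y, S y & `|a - y| * `|b| < e.
  split; apply: clI; apply/closure_normP => e /near[y Sy aye]; have [yb by_] := SI y Sy.
    by exists (y ** b) => //; rewrite -cmulBl; exact: le_lt_trans (cnormM _ _) aye.
  exists (b ** y) => //; rewrite -cmulBr; apply: (le_lt_trans (cnormM _ _)).
  by rewrite mulrC.
move=> e0; have [|y Sy ay] := Sa (e / (`|b| + 1)); first by rewrite divr_gt0.
exists y => //; rewrite ltr_pdivlMr// in ay; apply: le_lt_trans ay.
by rewrite ler_wpM2l// lerDl.
Qed.

(** The closure of an ideal of a dense subset is an ideal: first let the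
    multiplier leave the dense subset, then the multiplicand leave K. *)
Lemma closure_closed_ideal S K : closure S = setT -> K 0 ->
  (forall a b, K a -> K b -> K (a + b)) ->
  (forall (k : cplx R) a, K a -> K (k *: a)) ->
  (forall a b, K a -> S b -> K (b ** a) /\ K (a ** b)) ->
  closed_ideal (closure K).
Proof.
move=> dense K0 KD KZ KM; have clK : closed (closure K) by exact: closed_closure.
have KI a : K a -> closure K a by exact: subset_closure.
split=> //; first exact: KI.
- move=> a b /closure_normP Ia /closure_normP Ib; apply/closure_normP => e e0.
  have e2 : 0 < e / 2 by rewrite divr_gt0.
  have [y Ky ay] := Ia _ e2; have [z Kz bz] := Ib _ e2.
  exists (y + z); first exact: KD.
  rewrite opprD addrACA [e]splitr.
  by apply: (le_lt_trans (ler_normD _ _)); exact: ltrD.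
- move=> c a /closure_normP Ia; apply/closure_normP => e e0.
  have c1 : 0 < `|c| + 1 by rewrite ltr_wpDl.
  have [|y Ky ay] := Ia (e / (`|c| + 1)); first by rewrite divr_gt0.
  exists (c *: y); first exact: KZ.
  rewrite -scalerBr normrZ mulrC; rewrite ltr_pdivlMr// in ay.
  by apply: le_lt_trans ay; rewrite ler_wpM2l// lerDl.
move=> a b Ka; suff [h1 h2] : closure K (a ** b) /\ closure K (b ** a) by split.
apply: (mul_closure clK _ Ka) => y Ky; have Sb : closure S b by rewrite dense.
by have [] := mul_closure clK (fun z Sz => let: conj h h' := KM y z Ky Sz in
  conj (KI _ h) (KI _ h')) Sb.
Qed.

End closures_of_ideals.

Section star_homomorphisms.
Variables (R : realType) (Y : topologicalType) (B : cstarAlgType R).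
Let C := cplx R.
Variable phi : C0 R Y -> B.
Hypothesis phi_hom : star_hom_on setT phi.

Lemma conjC_real (r : R) : ((r%:C)%C : C)^* = (r%:C)%C.
Proof. by apply: conj_Creal; apply/complex_realP; exists r. Qed.

(** When |f y| = sin (u/2) with u in [0, pi], this is exp(i u) - 1. So it vanishes
    where f does, and if |f| <= 1 then 1 + v is a unitary of the unitization of
    C_0(Y). *)
Let v (f : C0 R Y) (y : Y) : C :=
  - 2 * ((cabs (f y) ^+ 2)%:C)%C +
  2 * 'i * ((cabs (f y) * Num.sqrt (1 - cabs (f y) ^+ 2))%:C)%C.

Let v_eqs (f : C0 R Y) y : `|f y| <= 1 ->
  (v f y)^* * v f y = 4 * ((f y)^* * f y) /\
  (v f y)^* + v f y = - (4 * ((f y)^* * f y)).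
Proof.
move=> f1; rewrite [(f y)^* * _]mulrC -normCK -cabsE -rmorphXn/=.
have r1 : cabs (f y) <= 1 by rewrite -lecR cabsE.
have r0 : 0 <= cabs (f y) by rewrite -ler0c cabsE.
rewrite /v; set r := cabs (f y) in r0 r1 *.
rewrite !rmorphD !rmorphM/= conjCi !conjC_real !rmorphN/= !conjC_nat.
set a : C := ((r ^+ 2)%:C)%C; set b : C := ((Num.sqrt (1 - r ^+ 2))%:C)%C.
have E : ((r%:C)%C : C) ^+ 2 * b ^+ 2 = a * (1 - a).
  rewrite /a /b -!rmorphXn/= sqr_sqrtr; last by rewrite subr_ge0 expr_le1.
  by rewrite rmorphB.
have i2 := sqrCi C; split; last by ring.
transitivity (4 * a ^+ 2 - 4 * 'i ^+ 2 * (((r%:C)%C : C) ^+ 2 * b ^+ 2)); first by ring.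
by rewrite E i2; ring.
Qed.

(** The identities for v give v* v = - (v* + v) = 4 f* f. By the C*-identity
    |phi v|^2 <= 2 |phi v|, so |phi v| <= 2, and |phi v|^2 = 4 |phi f|^2. *)
Lemma star_hom_contractive_unit (f : C0 R Y) : `|f| <= 1 -> `|phi f| <= 1.
Proof.
have [phiD phiZ phiM phiS] := phi_hom.
move=> f1; have fy1 y : `|f y| <= 1 by apply: le_trans f1; exact: C0_norm_ub.
have vC0 : v f \in @C0_pred R Y.
  apply: (@C0_dominated _ _ _ f 2) => [y|y]; last first.
    rewrite -(@ler_pXn2r _ 2)// ?nnegrE ?mulr_ge0// normCK mulrC.
    have [-> _] := v_eqs (fy1 y).
    by rewrite exprMn normCK [f y * _]mulrC -natrX.
  have cr : {for y, continuous (fun y => cabs (f y))}.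
    by apply: continuous_comp; [exact: C0_continuous|exact: cabs_continuous].
  have c2 : {for y, continuous (fun y => cabs (f y) ^+ 2)}.
    by apply: (@continuous_comp _ _ _ (fun y => cabs (f y)) (fun r => r ^+ 2));
      [exact: cr|exact: exprn_continuous].
  apply: cvgD.
    apply: cvgM; first exact: cvg_cst.
    by apply: (continuous_comp c2); exact: real_complex_continuous.
  apply: cvgM; first exact: cvg_cst.
  apply: (@continuous_comp _ _ _ (fun y => cabs (f y) * Num.sqrt (1 - cabs (f y) ^+ 2)));
    last exact: real_complex_continuous.
  apply: cvgM; first exact: cr.
  apply: (@continuous_comp _ _ _ (fun y => 1 - cabs (f y) ^+ 2)); last exact: sqrt_continuous.
  by apply: cvgB; [exact: cvg_cst|exact: c2].
pose w : C0 R Y := MkC0 vC0.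
have w1 : cstar w ** w = 4 *: (cstar f ** f).
  by apply: C0_ext => y; have [vv _] := v_eqs (fy1 y); exact: vv.
have w2 : cstar w + w = - (4 *: (cstar f ** f)).
  by apply: C0_ext => y; have [_ vv] := v_eqs (fy1 y); exact: vv.
have p1 : `|phi w| ^+ 2 = 4 * `|phi f| ^+ 2.
  rewrite -!cnormCstar -!phiS// -!phiM// w1 phiZ// normrZ.
  by rewrite normr_nat.
have p2 : `|phi w| ^+ 2 <= 2 * `|phi w|.
  rewrite -cnormCstar -phiS// -phiM// w1.
  have -> : phi (4 *: (cstar f ** f)) = - (cstar (phi w) + phi w).
    have pN x : phi (- x) = - phi x by rewrite -scaleN1r phiZ// scaleN1r.
    by rewrite -phiS// -phiD// w2 pN opprK.
  by rewrite normrN (le_trans (ler_normD _ _))// norm_cstar mulr_natl mulr2n.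
have p3 : `|phi w| <= 2.
  by apply: sqr_le_mul_cancel p2 => //; exact: normr_ge0.
rewrite -(@ler_pXn2r _ 2)// ?nnegrE// expr1n -(@ler_pM2l _ 4)// -p1 mulr1.
by apply: (le_trans p2); rewrite (_ : 4 = 2 * 2 :> C) ?ler_wpM2l// -natrM.
Qed.

Lemma star_hom_contractive (f : C0 R Y) : `|phi f| <= `|f|.
Proof.
have [_ phiZ _ _] := phi_hom; have [->|f0] := eqVneq f 0.
  by have := phiZ 0 0 I; rewrite !scale0r => ->; rewrite !normr0.
have nf : 0 < `|f| by rewrite normr_gt0.
have := @star_hom_contractive_unit (`|f|^-1 *: f).
rewrite phiZ// !normrZ normfV normr_id mulVf ?gt_eqF// => /(_ (lexx _)).
by rewrite mulrC ler_pdivrMr ?mul1r.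
Qed.

End star_homomorphisms.

(** * The finite set of group elements whose domain contains a point *)

Section partial_action_domains.
Variables (R : realType) (G : groupType) (X : topologicalType).
Variable (s : top_partial_action G X).
Implicit Types (tau : {fset G}) (x : X).

Definition dom_at x : {fset G} :=
  xget fset0 [set tau : {fset G} | forall g, g \in tau <-> tdom s g x].

Definition finite_domains (n : nat) :=
  forall x, Tn n (dom_at x) /\ forall g, g \in dom_at x <-> tdom s g x.

Lemma near_in_seq (I : eqType) (r : seq I) (P : I -> X -> Prop) x :
  (forall i, i \in r -> \forall y \near x, P i y) ->
  \forall y \near x, forall i, i \in r -> P i y.
Proof.
elim: r => [_|i r IH H]; first by apply: nearW.
have Pi : \forall y \near x, P i y by apply: H; rewrite mem_head.
have Pr : \forall y \near x, forall j, j \in r -> P j y.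
  by apply: IH => j jr; apply: H; rewrite in_cons jr orbT.
apply: filterS2 Pi Pr => y Piy Pry j; rewrite in_cons => /orP[/eqP->//|]; exact: Pry.
Qed.

Lemma ltransP g tau k : (k \in ltrans g tau) = ((g^-1 * k)%g \in tau).
Proof.
apply/imfsetP/idP => [[t /= tt ->]|kt]; first by rewrite mulKg.
by exists (g^-1 * k)%g => //; rewrite mulVKg.
Qed.

Lemma card_ltrans g tau : #|` ltrans g tau| = #|` tau|.
Proof. by rewrite card_imfset//; exact: mulgI. Qed.

Lemma ltransM g h tau : ltrans g (ltrans h tau) = ltrans (g * h)%g tau.
Proof. by apply/fsetP => k; rewrite !ltransP invgM mulgA. Qed.

Lemma ltrans1 tau : ltrans 1%g tau = tau.
Proof. by apply/fsetP => k; rewrite ltransP invg1 mul1g. Qed.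

Lemma Tn_ltrans n g tau : Tn n tau -> g^-1%g \in tau -> Tn n (ltrans g tau).
Proof. by move=> [_ nt] gt; split; rewrite ?card_ltrans// ltransP mulg1. Qed.

Lemma tdom_tact k g x : tdom s k^-1%g x ->
  tdom s g (tact s k x) <-> tdom s (k^-1 * g)%g x.
Proof.
move=> kx; split=> [gx|gx].
  have := @tactM _ _ s g^-1%g k x kx; rewrite invgK => /(_ gx)[].
  by rewrite invgM invgK.
have := @tactM _ _ s (k^-1 * g)^-1%g k^-1%g (tact s k x).
rewrite !invgK tactK// => /(_ (tact_dom kx) gx)[].
by rewrite -invgM mulVKg invgK.
Qed.

Variable hX : hausdorff_space X.
Let alpha := C0_partial_action R hX s.

Lemma pdomIE tau : pdomI alpha tau = C0_ideal (\bigcap_(g in [set` tau]) tdom s g).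
Proof.
apply/seteqP; split=> [f fI x nx|f fI g gt].
  apply: contrapT => fx0; apply: nx => g gt.
  by apply: contrapT => gx; apply: fx0; exact: (fI g gt).
suff : C0_ideal (tdom s g) f by [].
by move=> x gx; apply: fI => /(_ g gt).
Qed.

(** Density provides an element of some A_tau not vanishing at x, so that tau is
    contained in the set of all g with x in X_g. A further g with x in X_g would
    allow a bump function at x in the intersection of A_tau and A_g. *)
Lemma decomposition_finite_domains n : locally_compact [set: X] ->
  decomposition_property alpha n -> finite_domains n.
Proof.
move=> lcX [n0 dense disj] x.
have bump := @C0_bump R X hX lcX.
suff [tau [nt tP]] : exists tau, Tn n tau /\ forall g, g \in tau <-> tdom s g x.
  have E : dom_at x = tau.
    rewrite /dom_at; case: xgetP => [t -> {}/= tP'|/(_ tau)]; last by [].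
    by apply/fsetP => g; apply/idP/idP => [/tP'/tP|/tP/tP'].
  by rewrite E.
have [f fx _] := bump setT x (@filterT _ _ _).
have : closure (subspace_sum (@Tn G n) (pdomI alpha)) f by rewrite dense.
move=> /closure_normP/(_ 1 ltr01)[a [F [d [Fd ad]]] fa].
have ax : a x != 0.
  apply/eqP => ax; have := le_lt_trans (C0_norm_ub (f - a) x) fa.
  by rewrite C0B fx ax subr0 normr1 ltxx.
have [tau tF dx] : exists2 tau, tau \in F & d tau x != 0.
  apply: contrapT => H; move/negP: ax; apply; apply/eqP.
  rewrite ad C0_sum big_seq big1// => t tF; apply/eqP.
  by apply: contrapT => /negP dt; apply: H; exists t.
have [nt] := Fd _ tF; rewrite pdomIE => dt.
have tx : (\bigcap_(g in [set` tau]) tdom s g) x.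
  by apply: contrapT => /dt dx0; rewrite dx0 eqxx in dx.
exists tau; split=> // g; split=> [|gx]; first exact: tx.
apply: contrapT => /negP gt.
have nI : nbhs x (tdom s g `&` [set y | forall h, h \in tau -> tdom s h y]).
  apply: filterI; first by apply: open_nbhs_nbhs; split=> //; exact: tdom_open.
  apply: near_in_seq => h ht; apply: open_nbhs_nbhs; split; first exact: tdom_open.
  exact: tx.
have [b bx bI] := bump _ x nI.
have : (pdomI alpha tau `&` pdom alpha g) b.
  split; last by move=> y gy; apply: bI => -[].
  by rewrite pdomIE => y ty; apply: bI => -[_].
rewrite (disj tau g nt gt) => /= b0; move: bx; rewrite b0 => /eqP.
by rewrite eq_sym oner_eq0.
Qed.

End partial_action_domains.

Section finite_domain_theory.
Variables (G : groupType) (X : topologicalType) (s : top_partial_action G X).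
Variable n : nat.
Hypothesis fin : finite_domains s n.
Local Notation D := (dom_at s).

Lemma dom_atP x g : g \in D x <-> tdom s g x.
Proof. by have [_] := fin x. Qed.

Lemma Tn_dom_at x : Tn n (D x). Proof. by have [] := fin x. Qed.

Lemma dom_at1 x : 1%g \in D x. Proof. by have [] := Tn_dom_at x. Qed.

Lemma dom_at_sub tau x : Tn n tau -> (forall g, g \in tau -> tdom s g x) ->
  D x = tau.
Proof.
move=> [_ nt] sub; apply/esym/eqP; rewrite eqEfcard nt.
have [_ ->] := Tn_dom_at x; rewrite leqnn andbT.
by apply/fsubsetP => g /sub/dom_atP.
Qed.

(** The sets X_g are open, so nearby points lie in at least the same X_g; both
    sets of indices have n elements, hence they agree. *)
Lemma dom_at_near x : \forall y \near x, D y = D x.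
Proof.
have : \forall y \near x, forall g, g \in D x -> tdom s g y.
  apply: near_in_seq => g /dom_atP gx.
  by apply: open_nbhs_nbhs; split=> //; exact: tdom_open.
by apply: filterS => y; apply: dom_at_sub; exact: Tn_dom_at.
Qed.

Lemma dom_at_tact k x : tdom s k^-1%g x -> D (tact s k x) = ltrans k (D x).
Proof.
move=> kx; apply/fsetP => g; rewrite ltransP.
by apply/idP/idP => /dom_atP/(tdom_tact _ kx)/dom_atP.
Qed.

Lemma tact_near k x : tdom s k^-1%g x -> {for x, continuous (tact s k)}.
Proof.
move=> kx; have [_ + _] := tact_homeo s k.
by rewrite (continuous_open_subspace _ (tdom_open s _)); apply; rewrite inE.
Qed.

Lemma orbitP x y : orbit_proj s x = orbit_proj s y <->
  exists2 g, g \in D x & y = tact s g^-1%g x.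
Proof.
have E z : reflect (orbit_proj s x = orbit_proj s z) (orbit_rel s x z).
  exact: (eqmodP (orbit_equiv s) x z).
split=> [/E/asboolP[g gx yx]|[g /dom_atP gx ->]].
  by exists g^-1%g; [exact/dom_atP|rewrite invgK].
by apply/E/asboolP; exists g^-1%g; rewrite ?invgK.
Qed.

End finite_domain_theory.

(** * The orbit space *)

Section orbit_space_topology.
Variables (G : groupType) (X : topologicalType) (s : top_partial_action G X).
Variable n : nat.
Hypothesis fin : finite_domains s n.
Local Notation D := (dom_at s).
Local Notation proj := (orbit_proj s).

(** The saturation of an open set is open because partial homeomorphisms are
    defined and continuous near each point of their domain. *)
Lemma orbit_proj_nbhs x (U : set X) : nbhs x U -> nbhs (proj x) (proj @` U).
Proof.
rewrite nbhsE => -[V [oV Vx] VU].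
apply: (@filterS _ _ _ (proj @` V)) => [z [y /VU Uy <-]|]; first by exists y.
apply: open_nbhs_nbhs; split; last by exists x.
suff : open (proj @^-1` (proj @` V)) by [].
rewrite openE => y [v Vv /esym /(orbitP fin)[g gy vy]]; rewrite vy in Vv.
have gy' : tdom s g^-1^-1%g y by rewrite invgK; exact/(dom_atP fin).
have nV := open_nbhs_nbhs (conj oV Vv).
have := tact_near gy' nV; apply: filterS2 (dom_at_near fin y) => y' Dy Vy'.
exists (tact s g^-1%g y') => //; apply/esym/(orbitP fin).
by exists g => //; rewrite Dy.
Qed.

(** Separate the point y from each of the finitely many points of the orbit
    of x. Since D is locally constant, the orbit of a point x' near x consists of
    the images of x' under the same group elements, and so avoids a
    neighborhood of y. *)
Lemma orbit_space_hausdorff : hausdorff_space X -> hausdorff_space (orbit_space s).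
Proof.
move=> hX p q; rewrite -[p]reprK -[q]reprK => cl.
set x := repr p in cl *; set y := repr q in cl *.
apply: contrapT => pq.
have neq g : g \in D x -> tact s g^-1%g x <> y.
  by move=> gx xy; apply: pq; apply/(orbitP fin); exists g.
rewrite open_hausdorff in hX.
have /choice[W WP] : forall g, exists UV : set X * set X, g \in D x ->
    [/\ nbhs (tact s g^-1%g x) UV.1, nbhs y UV.2 & UV.1 `&` UV.2 = set0].
  move=> g; have [gx|gx] := boolP (g \in D x); last by exists (set0, set0).
  have /eqP/hX[[U V] /= [Ux Vy] [oU oV /eqP UV]] := neq g gx.
  exists (U, V) => _; split=> //; apply: open_nbhs_nbhs; split=> //; exact: set_mem.
have nx : \forall x' \near x, D x' = D x /\
    forall g, g \in D x -> (W g).1 (tact s g^-1%g x').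
  apply: filterI; first exact: dom_at_near fin x.
  apply: near_in_seq => g gx; have [nU _ _] := WP g gx.
  by apply: (tact_near _ nU); rewrite invgK; exact/(dom_atP fin).
have ny : \forall y' \near y, forall g, g \in D x -> (W g).2 y'.
  by apply: near_in_seq => g gx; have [_ nV _] := WP g gx.
have [z [[x' [Dx' Ux'] xz] [y' Vy' yz]]] :=
  cl _ _ (orbit_proj_nbhs nx) (orbit_proj_nbhs ny).
have /(orbitP fin)[g] : proj x' = proj y' by rewrite xz.
rewrite Dx' => gx E; have [_ _ UV] := WP g gx.
suff : set0 y' by []; rewrite -UV; split; last exact: Vy'.
by rewrite E; exact: Ux'.
Qed.

Lemma orbit_proj_continuous : continuous proj.
Proof. exact: pi_continuous. Qed.

Lemma orbit_space_locally_compact : hausdorff_space X ->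
  locally_compact [set: X] -> locally_compact [set: orbit_space s].
Proof.
move=> hX lcX z _; rewrite -[z]reprK; set x := repr z.
have [K Kx [cK clK]] := lcX x I.
have cpK : compact (proj @` K).
  apply: continuous_compact cK; apply: continuous_subspaceT => ?.
  exact: orbit_proj_continuous.
exists (proj @` K).
  by rewrite withinET; apply: orbit_proj_nbhs; rewrite withinET in Kx.
by split=> //; apply: compact_closed cpK; exact: orbit_space_hausdorff.
Qed.

(** If K is compact and D is constant on K, the saturation of K is a finite
    union of images s_{g^-1} K, hence compact. The images of the interiors of
    such K cover the orbit space, so finitely many of them cover L. *)
Lemma orbit_proj_proper (L : set (orbit_space s)) : hausdorff_space X ->
  locally_compact [set: X] -> compact L -> compact (proj @^-1` L).
Proof.
move=> hX lcX cL.
have clD x : closed [set y | D y = D x].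
  move=> y /(_ _ (dom_at_near fin y))[y' [/= <- ->]]; by [].
have /choice[K KP] : forall x, exists K, [/\ nbhs x K, compact K &
    forall y, K y -> D y = D x].
  move=> x; have [K Kx [cK clK]] := lcX x I; rewrite withinET in Kx.
  exists (K `&` [set y | D y = D x]); split=> [||y []//].
    by apply: filterI => //; exact: dom_at_near.
  by apply: subclosed_compact cK _; [exact: closedI|exact: subIsetl].
have [| |F _ FL] := compact_cover_compact cL (D := [set: X])
  (f := fun x => (proj @` K x)°).
- by move=> x _; exact: open_interior.
- move=> z _; exists (repr z) => //; rewrite -{2}[z]reprK.
  by apply: orbit_proj_nbhs; have [] := KP (repr z).
have clL : closed (proj @^-1` L).
  apply: preimage_closed (compact_closed (orbit_space_hausdorff hX) cL) => x _.
  exact: orbit_proj_continuous.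
pose M := \big[setU/set0]_(x <- F) \big[setU/set0]_(g <- D x) (tact s g^-1%g @` K x).
apply: (@subclosed_compact _ _ M) => // [|y /FL[x /= Fx] /interior_subset[k Kk]].
  rewrite /M; apply: bigsetU_compact => x _.
  rewrite big_seq; apply: bigsetU_compact => g gx.
  have [_ cK KD] := KP x; apply: continuous_compact cK.
  have [_ + _] := tact_homeo s g^-1%g; apply: continuous_subspaceW => y /KD Dy.
  by rewrite invgK; apply/(dom_atP fin); rewrite Dy.
move=> /(orbitP fin)[g gk ->]; have [_ _ KD] := KP x.
rewrite /M -bigcup_seq; exists x => //=; rewrite -bigcup_seq.
by exists g; [rewrite /= -(KD k Kk)|exists k].
Qed.

End orbit_space_topology.

(** * The fixed point algebra *)

Section fixed_point_algebra.
Variables (R : realType) (G : groupType) (X : topologicalType).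
Variables (s : top_partial_action G X) (n : nat).
Hypotheses (hX : hausdorff_space X) (lcX : locally_compact [set: X]).
Hypothesis fin : finite_domains s n.
Let alpha := C0_partial_action R hX s.
Local Notation D := (dom_at s).
Local Notation proj := (orbit_proj s).

(** Evaluate the defining equation at x against a bump function b of A_g equal
    to 1 at s_g x. *)
Lemma fixed_algebraP f : fixed_algebra alpha f <->
  forall g x, tdom s g^-1%g x -> f (tact s g x) = f x.
Proof.
split=> [fix_f g x gx|inv g b bg].
  have [b bx bI] : exists2 b : C0 R X, b (tact s g x) = 1 & C0_ideal (tdom s g) b.
    apply: C0_bump => //; apply: open_nbhs_nbhs.
    by split; [exact: tdom_open|exact: tact_dom].
  have bI' : C0_ideal (tdom s g^-1^-1%g) b by rewrite invgK.
  have fbI : C0_ideal (tdom s g^-1^-1%g) (f ** b).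
    by move=> y /bI' by0; rewrite C0_cmulE by0 mulr0.
  have := congr1 (fun h : C0 R X => h x) (fix_f g b bI).
  have -> : pact alpha = C0_act s by [].
  rewrite C0_cmulE (C0_act_in hX fbI gx) (C0_act_in hX bI' gx) invgK.
  by rewrite C0_cmulE bx !mulr1.
apply: C0_ext => x; rewrite C0_cmulE /=.
have bI' : C0_ideal (tdom s g^-1^-1%g) b by rewrite invgK.
have fbI : C0_ideal (tdom s g^-1^-1%g) (f ** b).
  by move=> y /bI' by0; rewrite C0_cmulE by0 mulr0.
have [gx|gx] := pselect (tdom s g^-1%g x).
  rewrite (C0_act_in hX fbI gx) (C0_act_in hX bI' gx) C0_cmulE invgK.
  by rewrite (inv _ _ gx).
by rewrite (C0_act_out hX fbI gx) (C0_act_out hX bI' gx) mulr0.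
Qed.

Lemma fixed_algebra_orbit f x y : fixed_algebra alpha f ->
  proj x = proj y -> f x = f y.
Proof.
move=> /fixed_algebraP inv /(orbitP fin)[g /(dom_atP fin) gx ->].
by rewrite inv// invgK.
Qed.

Lemma descend_subproof (f : C0 R X) : fixed_algebra alpha f ->
  (f \o (repr : orbit_space s -> X)) \in @C0_pred R (orbit_space s).
Proof.
move=> ff; have fE x : f (repr (proj x)) = f x.
  by apply: fixed_algebra_orbit ff _; rewrite /orbit_proj reprK.
apply/C0P; split.
  apply/quotient_continuous => x.
  have -> : (f \o (repr : orbit_space s -> X)) \o \pi_(orbit_space s)%qT = f.
    by apply/funext => y; exact: fE.
  exact: C0_continuous.
move=> e e0; have [K cK fK] := C0_vanishes f e0; exists (proj @` K).
  apply: continuous_compact cK; apply: continuous_subspaceT => ?.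
  exact: orbit_proj_continuous.
move=> z Kz; apply: fK => Kx; apply: Kz; exists (repr z) => //.
by rewrite /orbit_proj reprK.
Qed.

Definition descend (f : C0 R X) : C0 R (orbit_space s) :=
  insubd 0 (f \o (repr : orbit_space s -> X)).

Lemma descendE f z : fixed_algebra alpha f -> descend f z = f (repr z).
Proof. by move=> /descend_subproof ?; rewrite /descend [C0_fun _]insubdK. Qed.

Lemma descend_proj f x : fixed_algebra alpha f -> descend f (proj x) = f x.
Proof.
move=> ff; rewrite descendE//; apply: fixed_algebra_orbit ff _.
by rewrite /orbit_proj reprK.
Qed.

(** Vanishing at infinity is where properness of the projection is needed. *)
Lemma pullback_subproof (q : C0 R (orbit_space s)) :
  (q \o proj) \in @C0_pred R X.
Proof.
apply/C0P; split=> [x|e e0].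
  by apply: continuous_comp; [exact: orbit_proj_continuous|exact: C0_continuous].
have [K cK qK] := C0_vanishes q e0; exists (proj @^-1` K).
  exact: orbit_proj_proper fin _ hX lcX cK.
by move=> x Kx; exact: qK.
Qed.

Definition pullback (q : C0 R (orbit_space s)) : C0 R X :=
  MkC0 (pullback_subproof q).

Lemma pullback_fixed q : fixed_algebra alpha (pullback q).
Proof.
apply/fixed_algebraP => g x gx /=; congr (q _).
by apply/esym/(orbitP fin); exists g^-1%g; rewrite ?invgK//; exact/(dom_atP fin).
Qed.

Lemma descend_iso : star_iso_on (fixed_algebra alpha) setT descend.
Proof.
have closed_op (f : C0 R X) : (exists g h : C0 R X, exists op : cplx R -> cplx R -> cplx R,
    [/\ fixed_algebra alpha g, fixed_algebra alpha h &
        forall x, f x = op (g x) (h x)]) -> fixed_algebra alpha f.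
  move=> [g [h [op [/fixed_algebraP gf /fixed_algebraP hf fE]]]].
  by apply/fixed_algebraP => k x kx; rewrite !fE gf ?hf.
split; split.
- move=> f g ff fg; have h : fixed_algebra alpha (f + g).
    by apply: closed_op; exists f, g, +%R.
  apply: C0_ext => z; rewrite (descendE z h) -[RHS]/(descend f z + descend g z).
  by rewrite (descendE z ff) (descendE z fg).
- move=> k f ff; have h : fixed_algebra alpha (k *: f).
    by apply: closed_op; exists f, f, (fun u v => k * u).
  apply: C0_ext => z; rewrite (descendE z h) -[RHS]/(k * descend f z).
  by rewrite (descendE z ff).
- move=> f g ff fg; have h : fixed_algebra alpha (f ** g).
    by apply: closed_op; exists f, g, *%R.
  apply: C0_ext => z; rewrite (descendE z h) -[RHS]/(descend f z * descend g z).
  by rewrite (descendE z ff) (descendE z fg).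
- move=> f ff; have h : fixed_algebra alpha (cstar f).
    by apply: closed_op; exists f, f, (fun u v => u^*).
  apply: C0_ext => z; rewrite (descendE z h) -[RHS]/((descend f z)^*).
  by rewrite (descendE z ff).
- by [].
- move=> f g /set_mem ff /set_mem fg fg'; apply: C0_ext => x.
  by rewrite -(descend_proj x ff) fg' descend_proj.
- move=> q _; exists (pullback q); first exact: pullback_fixed.
  apply: C0_ext => z; rewrite descendE /=; last exact: pullback_fixed.
  by rewrite /orbit_proj reprK.
Qed.

End fixed_point_algebra.

(** * Finite sums in the crossed product *)

Section finite_sum_calculus.
Variables (R : realType) (G : groupType) (X : topologicalType).
Variables (s : top_partial_action G X) (n : nat).
Hypotheses (hX : hausdorff_space X) (fin : finite_domains s n).
Let C := cplx R.
Let alpha := C0_partial_action R hX s.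
Local Notation D := (dom_at s).
Local Notation fs := (finite_sums alpha).
Implicit Types (x y : G -> C0 R X).

Lemma pact_C0 g f : pact alpha g f = C0_act s g f. Proof. by []. Qed.

Lemma fs_addE x y g z : (x + y) g z = x g z + y g z. Proof. by []. Qed.
Lemma fs_subE x y g z : (x - y) g z = x g z - y g z. Proof. by []. Qed.
Lemma fs_scaleE (c : C) x g z : (c *: x) g z = c * x g z. Proof. by []. Qed.

Lemma fs_sumE (I : Type) (r : seq I) (F : I -> G -> C0 R X) g z :
  (\sum_(i <- r) F i) g z = \sum_(i <- r) F i g z.
Proof.
elim: r => [|i r IH]; first by rewrite !big_nil.
by rewrite !big_cons fs_addE IH.
Qed.

Lemma fs_supp x g z : fs x -> g \notin D z -> x g z = 0.
Proof.
move=> [_ xI] gz; have : C0_ideal (tdom s g) (x g) by exact: xI.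
by apply => /(dom_atP fin); exact/negP.
Qed.

(** The convolution formula of the transformation groupoid: at z only the
    finitely many g with z in X_g contribute. *)
Lemma fs_mulE x y k z : fs x ->
  fs_mul alpha x y k z =
  \sum_(g <- D z) x g z * y (g^-1 * k)%g (tact s g^-1%g z).
Proof.
move=> fx; have [xfin xI] := fx.
have xI' g : C0_ideal (tdom s g^-1^-1%g) (x g) by rewrite invgK; exact: xI.
pose T g : C0 R X := C0_act s g (C0_act s g^-1%g (x g) ** y (g^-1 * k)%g).
pose F := fset_set [set g | x g != 0].
have T0 g : g \notin F -> T g = 0.
  rewrite in_fset_set// notin_setE /= => /negP; rewrite negbK => /eqP xg0.
  have := pact0 alpha g; rewrite pact_C0 => a0.
  have := pact0 alpha g^-1%g; rewrite pact_C0 => a1.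
  by rewrite /T xg0 a1 cmul0r a0.
have -> : fs_mul alpha x y k = \sum_(g <- F) T g by exact: fsbigTE.
rewrite C0_sum.
have TE g : T g z = if g \in D z then x g z * y (g^-1 * k)%g (tact s g^-1%g z) else 0.
  have aI := C0_act_ideal hX (xI' g).
  have pI : C0_ideal (tdom s g^-1%g) (C0_act s g^-1%g (x g) ** y (g^-1 * k)%g).
    by move=> w /aI w0; rewrite C0_cmulE w0 mul0r.
  rewrite /T; case: ifPn => [/(dom_atP fin) gz|gz].
    rewrite (C0_act_in hX pI gz) C0_cmulE (C0_act_in hX (xI' g)); last exact: tactV_dom.
    by rewrite invgK tactVK.
  by rewrite (C0_act_out hX pI)// => /(dom_atP fin); exact/negP.
transitivity (\sum_(g <- (F `|` D z)%fset) T g z).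
  by apply: big_fset_incl; [exact: fsubsetUl|move=> g _ /T0 ->].
transitivity (\sum_(g <- D z) T g z).
  apply/esym/big_fset_incl; first exact: fsubsetUr.
  by move=> g _ /negbTE gz; rewrite TE gz.
by rewrite big_seq [RHS]big_seq; apply: eq_bigr => g gz; rewrite TE gz.
Qed.

Lemma fs_starE x k z : fs x ->
  fs_star alpha x k z =
  if k \in D z then (x k^-1%g (tact s k^-1%g z))^* else 0.
Proof.
move=> [_ xI]; rewrite /fs_star pact_C0.
have sI : C0_ideal (tdom s k^-1%g) (cstar (x k^-1%g)).
  by move=> w kw; rewrite C0_cstarE (xI k^-1%g w kw) rmorph0.
case: ifPn => [/(dom_atP fin) kz|kz]; first by rewrite (C0_act_in hX sI kz).
by rewrite (C0_act_out hX sI)// => /(dom_atP fin); exact/negP.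
Qed.

Lemma fs_add x y : fs x -> fs y -> fs (x + y).
Proof.
move=> [xfin xI] [yfin yI]; split.
  have : finite_set ([set g | x g != 0] `|` [set g | y g != 0]) by rewrite finite_setU.
  apply: sub_finite_set => g /=; rewrite -[(x + y) g]/(x g + y g).
  have [->|xg] := eqVneq (x g) 0; last by left.
  by rewrite add0r; right.
move=> g; have [_ _ addI _ _] := pdom_ideal alpha g; exact: addI.
Qed.

Lemma fs_scale (c : C) x : fs x -> fs (c *: x).
Proof.
move=> [xfin xI]; split.
  apply: sub_finite_set xfin => g /=; apply: contraNN => /eqP xg.
  by rewrite [X in X == _](_ : _ = c *: x g)// xg scaler0.
by move=> g; have [_ _ _ scI _] := pdom_ideal alpha g; exact: scI.
Qed.

Lemma fs_sub x y : fs x -> fs y -> fs (x - y).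
Proof. by move=> fx fy; rewrite -scaleN1r; exact/fs_add/fs_scale. Qed.

Lemma fs_mul_closed x y : fs x -> fs y -> fs (fs_mul alpha x y).
Proof.
move=> fx fy; have [xfin xI] := fx; have [yfin yI] := fy.
have key k z : fs_mul alpha x y k z <> 0 -> exists g,
    [/\ g \in D z, x g z != 0 & y (g^-1 * k)%g (tact s g^-1%g z) != 0].
  move=> xyz; apply: contrapT => H; apply: xyz; rewrite fs_mulE//.
  rewrite big_seq big1// => g gz; apply/eqP; rewrite mulf_eq0.
  apply: contrapT => /negP; rewrite negb_or => /andP[xg yg].
  by apply: H; exists g.
split=> [|k].
  have : finite_set [set (g * h)%g | g in [set g | x g != 0] & h in [set h | y h != 0]].
    exact: finite_image2.
  apply: sub_finite_set => k /= xyk.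
  have [z /key[g [_ xg yg]]] : exists z, fs_mul alpha x y k z <> 0.
    apply: contrapT => H; move/negP: xyk; apply; apply/eqP/C0_ext => z.
    by apply: contrapT => z0; apply: H; exists z.
  exists g; first by apply: contra_neq xg => ->.
  exists (g^-1 * k)%g; first by apply: contra_neq yg => ->.
  by rewrite mulVKg.
suff : C0_ideal (tdom s k) (fs_mul alpha x y k) by [].
move=> z kz; apply: contrapT => /key[g [/(dom_atP fin) gz _ yg]]; apply: kz.
have /(dom_atP fin) : (g^-1 * k)%g \in D (tact s g^-1%g z).
  by apply: contraNT yg => /(fs_supp fy) ->.
have gz' : tdom s g^-1^-1%g z by rewrite invgK.
by move=> /(tdom_tact _ gz'); rewrite invgK mulVKg.
Qed.

Lemma fs_star_closed x : fs x -> fs (fs_star alpha x).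
Proof.
move=> fx; have [xfin xI] := fx.
split=> [|k].
  have : finite_set [set (g^-1)%g | g in [set g | x g != 0]] by exact: finite_image.
  apply: sub_finite_set => k /= xk; exists k^-1%g; last by rewrite invgK.
  apply: contra_neq xk => xk0; apply: C0_ext => z.
  by rewrite fs_starE// xk0 rmorph0; case: ifP.
suff : C0_ideal (tdom s k) (fs_star alpha x k) by [].
by move=> z kz; rewrite fs_starE//; case: ifP => // /(dom_atP fin).
Qed.

Lemma fs_monomial f g : C0_ideal (tdom s g) f -> fs (monomial f g).
Proof.
move=> fg; split=> [|k].
  apply: (@sub_finite_set _ _ [set g]) => // k /=; rewrite /monomial.
  by have [//|_] := eqVneq k g; rewrite eqxx.
by rewrite /monomial; case: eqP => [->//|_]; exact: pdom0.
Qed.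

Lemma C0_ideal_tdom1 (f : C0 R X) : C0_ideal (tdom s 1%g) f.
Proof. by move=> z; rewrite tdom1 => /(_ I). Qed.

Lemma fs_monomial1 f : fs (monomial f 1%g).
Proof. by apply: fs_monomial; exact: C0_ideal_tdom1. Qed.

Lemma mul_monomial1E f x k z : fs x ->
  fs_mul alpha (monomial f 1%g) x k z = f z * x k z.
Proof.
move=> fx; rewrite (fs_mulE _ _ _ (fs_monomial1 f)).
rewrite (big_fsetD1 1%g)/=; last exact: dom_at1 fin _.
rewrite big_seq big1 ?addr0 => [|g].
  by rewrite /monomial eqxx invg1 mul1g tact1.
by rewrite !inE /monomial => /andP[/negbTE -> _]; rewrite mul0r.
Qed.

Lemma mul_monomialrE f x k z : fs x ->
  fs_mul alpha x (monomial f 1%g) k z =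
  if k \in D z then x k z * f (tact s k^-1%g z) else 0.
Proof.
move=> fx; rewrite fs_mulE//; case: ifPn => kz.
  rewrite (big_fsetD1 k)//= big_seq big1 ?addr0 => [|g].
    by rewrite /monomial mulVg eqxx.
  rewrite !inE /monomial => /andP[gk _]; case: eqP => [E|]; last by rewrite mulr0.
  by move: gk; rewrite -[k](mulVKg g) E mulg1 eqxx.
rewrite big_seq big1// => g gz; rewrite /monomial.
case: eqP => [E|_]; last by rewrite mulr0.
by move: kz; rewrite -[k](mulVKg g) E mulg1 gz.
Qed.

Section embedding.
Variable B : crossed_product alpha.

Lemma cp_emb0 : cp_emb B 0 = 0.
Proof.
by have := cp_embZ B 0 (fs_monomial1 0); rewrite !scale0r.
Qed.

Lemma cp_embB x y : fs x -> fs y -> cp_emb B (x - y) = cp_emb B x - cp_emb B y.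
Proof.
move=> fx fy; rewrite -scaleN1r cp_embD//; last exact: fs_scale.
by rewrite cp_embZ// scaleN1r.
Qed.

Lemma cp_emb_monomial1_hom : star_hom_on setT (fun f => cp_emb B (monomial f 1%g)).
Proof.
split.
- move=> f g _ _; rewrite -cp_embD; [|exact: fs_monomial1|exact: fs_monomial1].
  congr (cp_emb B _); apply/funext => k.
  rewrite [RHS](_ : _ = monomial f 1%g k + monomial g 1%g k)// /monomial.
  by case: eqP; rewrite ?addr0.
- move=> c f _; rewrite -cp_embZ; last exact: fs_monomial1.
  congr (cp_emb B _); apply/funext => k.
  rewrite [RHS](_ : _ = c *: monomial f 1%g k)// /monomial.
  by case: eqP; rewrite ?scaler0.
- move=> f g _ _; rewrite -cp_embM; [|exact: fs_monomial1|exact: fs_monomial1].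
  congr (cp_emb B _); apply/funext => k; apply: C0_ext => z.
  rewrite mul_monomial1E; last exact: fs_monomial1.
  by rewrite /monomial; case: eqP; rewrite ?C0_cmulE ?mulr0.
- move=> f _; rewrite -cp_emb_star; last exact: fs_monomial1.
  by rewrite fs_star_monomial pact_C0 invg1 C0_act1.
Qed.

(** Automatic continuity: f |-> f delta_1 is a star homomorphism on C_0(X). *)
Lemma norm_cp_emb_monomial1 f : `|cp_emb B (monomial f 1%g)| <= `|f|.
Proof. exact: (star_hom_contractive cp_emb_monomial1_hom). Qed.

(** (f delta_g) (f delta_g)* = |f|^2 delta_1. *)
Lemma norm_cp_emb_monomial f g : C0_ideal (tdom s g) f ->
  `|cp_emb B (monomial f g)| <= `|f|.
Proof.
move=> fg; have ff := fs_monomial fg; have fsf := fs_star_closed ff.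
rewrite -(@ler_pXn2r _ 2)// ?nnegrE// -norm_cstar -cnormCstar cstarK.
rewrite -cp_emb_star// -cp_embM//.
have -> : fs_mul alpha (monomial f g) (fs_star alpha (monomial f g)) =
    monomial (f ** cstar f) 1%g.
  apply/funext => k; apply: C0_ext => z; rewrite fs_mulE//.
  have [gz|gz] := boolP (g \in D z); last first.
    have f0 : f z = 0 by apply: fg => /(dom_atP fin); exact/negP.
    rewrite big_seq big1 => [|h hz].
      by rewrite /monomial; case: eqP; rewrite ?C0_cmulE ?f0 ?mul0r.
    rewrite /monomial; case: eqP => [E|]; last by rewrite mul0r.
    by rewrite f0 mul0r.
  rewrite (big_fsetD1 g)//= big_seq big1 ?addr0 => [|h]; last first.
    by rewrite !inE /monomial => /andP[/negbTE -> _]; rewrite mul0r.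
  have gz' : tdom s g^-1^-1%g z by rewrite invgK; exact/(dom_atP fin).
  rewrite fs_starE// (dom_at_tact fin gz') ltransP invgK mulVKg.
  rewrite /monomial eqxx.
  have -> : ((g^-1 * k)^-1 == g)%g = (k == 1%g).
    rewrite -eqg_inv invgK.
    by apply/eqP/eqP => [E|->]; rewrite ?mulg1// -[k](mulVKg g) E mulgV.
  case: (eqVneq k 1%g) => [->|_]; last by rewrite rmorph0 if_same mulr0.
  by rewrite (dom_at1 fin) mulg1 invgK tactVK//; exact/(dom_atP fin).
apply: (le_trans (norm_cp_emb_monomial1 _)); apply: (le_trans (cnormM _ _)).
by rewrite norm_cstar -expr2.
Qed.

End embedding.

End finite_sum_calculus.

(** * Components of functions in direct sums of ideals *)

Section components.
Variables (R : realType) (X : topologicalType).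
Implicit Types (a f : C0 R X).

(** Truncation to U_j is the component: the remainder is approximated by the sum
    of the truncations of a to finitely many U_i that cover the compact set
    where |a| is not small. Conversely, limits of sums of functions supported off
    U_j vanish on U_j, which gives uniqueness. *)
Lemma component_C0E (I : choiceType) (J : set I) (U : I -> set X)
    (V : I -> set (C0 R X)) (j : I) a : J j ->
  (forall i, J i -> V i = C0_ideal (U i)) -> (forall i, J i -> open (U i)) ->
  trivIset J U -> (forall x, a x != 0 -> exists2 i, J i & U i x) ->
  component J V j a = C0_cut (U j) a.
Proof.
move=> Jj VE oU tU aU.
have tU' i k x : J i -> J k -> U i x -> U k x -> i = k.
  by move=> Ji Jk Ui Uk; apply: tU => //; exists x.
have cutE i x : J i -> C0_cut (U i) a x = if x \in U i then a x else 0.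
  move=> Ji; apply: C0_cutE => [|y nUy ay]; first exact: oU.
  have [k Jk Uk] := aU _ ay.
  have := open_nbhs_nbhs (conj (oU _ Jk) Uk); apply: filterS => y' Uky' Uiy'.
  by apply: nUy; rewrite (tU' i k y').
have cutV i : J i -> V i (C0_cut (U i) a).
  by move=> Ji; rewrite VE// => x nUx; rewrite cutE// memNset.
rewrite /component; case: xgetP => [b _ [Vb clb]|/(_ (C0_cut (U j) a)) H]; last first.
  exfalso; apply: H; split; first exact: cutV.
  apply/closure_normP => e e0; have e2 : 0 < e / 2 by rewrite divr_gt0.
  have cL := @C0_level_compact _ _ a _ e2.
  have [|x /= Lx|F FJ LF] := compact_cover_compact cL (D := J) (f := U); first exact: oU.
    by apply: aU; rewrite -normr_gt0; exact: lt_le_trans Lx.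
  exists (\sum_(i <- (F `\ j)%fset) C0_cut (U i) a).
    exists (F `\ j)%fset, (fun i => C0_cut (U i) a); split=> // i.
    rewrite !inE => /andP[/eqP ij /FJ/set_mem Ji]; split; last exact: cutV.
    by split.
  apply: (@le_lt_trans _ _ (e / 2)); last by rewrite gtr_pMr// invf_lt1 ?ltr1n.
  apply: C0_norm_le => [|x]; first exact: ltW.
  rewrite !C0B C0_sum cutE//.
  have [ax|ax] := eqVneq (a x) 0.
    rewrite big_seq big1 => [|i]; first by rewrite ax if_same !subr0 normr0 ltW.
    by rewrite !inE => /andP[_ /FJ/set_mem Ji]; rewrite cutE// ax if_same.
  have [k Jk Uk] := aU _ ax.
  have out i : i \in (F `\ j)%fset -> i != k -> C0_cut (U i) a x = 0.
    rewrite !inE => /andP[_ /FJ/set_mem Ji] ik; rewrite cutE// memNset// => Ui.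
    by move/eqP: ik; apply; exact: tU' Ui Uk.
  have [kj|kj] := eqVneq k j.
    rewrite kj in Uk out; rewrite mem_set// big_seq big1 => [|i iF].
      by rewrite subrr subr0 normr0 ltW.
    by apply: out => //; move: iF; rewrite !inE => /andP[].
  rewrite memNset => [|Uj]; last by move/eqP: kj; apply; exact: tU' Uk Uj.
  rewrite subr0; have [kF|kF] := boolP (k \in (F `\ j)%fset).
    rewrite (big_fsetD1 k)//= cutE// mem_set// big_seq big1.
      by rewrite addr0 subrr normr0 ltW.
    by move=> i; rewrite in_fsetD1 => /andP[ik iF]; exact: out.
  rewrite big_seq big1 => [|i iF]; last first.
    by apply: out => //; apply: contraNneq kF => <-.
  rewrite subr0; have : e / 2 \is Num.real by exact: gtr0_real.
  move=> /real_leVge -/(_ _ (normr_real (a x)))/orP[Lx|//].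
  have [i /= iF Ui] := LF x Lx; have /FJ/set_mem Ji := iF.
  by move: kF; rewrite (tU' _ _ _ Jk Ji Uk Ui) !inE iF andbT (tU' _ _ _ Ji Jk Ui Uk) kj.
apply: C0_ext => x; rewrite cutE//; rewrite VE// in Vb.
have [Ux|Ux] := boolP (x \in U j); last by apply: Vb => /mem_set; exact/negP.
have : C0_ideal (~` U j) (a - b).
  have [clI _ _ _ _] := @C0_ideal_closed_ideal R X (~` U j).
  apply: clI; apply: closureS clb => _ [F [d [Fd ->]]] y /contrapT Uy.
  rewrite C0_sum big_seq big1// => i /Fd[[Ji /= ij]]; rewrite VE// => di.
  by apply: di => Uiy; apply: ij; exact: tU' Uiy Uy.
move=> /(_ x); rewrite C0B => ab; apply/esym/eqP; rewrite -subr_eq0; apply/eqP.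
by apply: ab => /(_ (set_mem Ux)).
Qed.

End components.

(** * Orbits of finite subsets and cosets of their stabilizers *)

Section orbits_of_domains.
Variable G : groupType.
Implicit Types (tau : {fset G}).

Lemma Torbit_refl tau : 1%g \in tau -> Torbit tau tau.
Proof. by move=> t1; exists 1%g; rewrite ?ltrans1//= invg1. Qed.

Lemma Torbit_eq tau tau' : Torbit tau tau' -> Torbit tau' = Torbit tau.
Proof.
move=> [g /= gt <-]; apply/seteqP; split=> _ [h /= ht <-].
  exists (h * g)%g; last by rewrite ltransM.
  by move: ht; rewrite ltransP /= invgM.
exists (h * g^-1)%g; last by rewrite ltransM mulgVK.
by rewrite /= ltransP invgM invgK mulKg.
Qed.

Lemma Torbit_Tn n tau tau' : Tn n tau -> Torbit tau tau' -> Tn n tau'.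
Proof. by move=> nt [g /= gt <-]; exact: Tn_ltrans. Qed.

Lemma Torbits_mem n w tau : Torbits n w -> w tau -> w = Torbit tau /\ Tn n tau.
Proof.
move=> [t nt <-] wt; split; last exact: Torbit_Tn nt wt.
by rewrite (Torbit_eq wt).
Qed.

Section cosets.
Variables (n : nat) (tau : {fset G}) (x : nat -> G).
Hypotheses (nt : Tn n tau) (cx : coset_reps tau x).
Local Notation m1 := (stab_index tau).

Let t1 : 1%g \in tau. Proof. by case: nt. Qed.

Lemma stab_id h : h \in stab tau -> ltrans h tau = tau.
Proof. by rewrite stabP// => /eqP. Qed.

Lemma stab1 : 1%g \in stab tau.
Proof. by rewrite stabP// ltrans1. Qed.

Lemma coset_repE g : g \in tau -> exists2 j : 'I_m1, exists2 h, h \in stab tau & g = (h * x j)%g &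
  forall k : 'I_m1, forall h, h \in stab tau -> g = (h * x k)%g -> k = j.
Proof.
have [_ cov triv] := cx => gt; have : [set` tau] g by [].
rewrite cov => -[j /= jm [h ht gE]]; exists (Ordinal jm); first by exists h.
move=> k h' ht' gE'; apply/val_inj/triv; rewrite /= ?ltn_ord//.
by exists g; split; [exists h'|exists h].
Qed.

Lemma coset_rep_mem h (j : 'I_m1) : h \in stab tau -> (h * x j)%g \in tau.
Proof.
have [_ cov _] := cx => ht; suff : [set` tau] (h * x j)%g by [].
by rewrite cov; exists j; [exact: ltn_ord|exists h].
Qed.

(** Every element of tau is h x_k for exactly one pair (k, h). This is what
    reduces the double sum in the definition of c to an indicator function. *)
Lemma sum_cosets g :
  (\sum_(k < m1) \sum_(h <- stab tau) (g == h * x k)%g = (g \in tau))%N.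
Proof.
have [gt|gt] := boolP (g \in tau); last first.
  rewrite big1// => k _; rewrite big_seq big1// => h ht.
  by apply/eqP; rewrite eqb0; apply: contraNneq gt => ->; exact: coset_rep_mem.
have [j [h ht gE] uj] := coset_repE gt.
rewrite (bigD1 j)//= (big_fsetD1 h)//= -gE eqxx big_seq big1 ?addn0.
  rewrite big1 ?addn0// => k kj; rewrite big_seq big1// => h' ht'.
  by apply/eqP; rewrite eqb0; apply: contraNneq kj => /(uj _ _ ht') ->.
move=> h'; rewrite !inE => /andP[hh _]; apply/eqP; rewrite eqb0.
by apply: contraNneq hh; rewrite gE => /mulIg ->.
Qed.

Lemma card_stab_index : (#|` stab tau| * m1 = n)%N.
Proof.
have [_ <-] := nt.
have -> : #|` tau| = (\sum_(g <- tau) (g \in tau))%N.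
  by rewrite big_seq (eq_bigr (fun=> 1%N)) => [|g ->//]; rewrite -big_seq sum1_size.
under [RHS]eq_bigr do rewrite -sum_cosets.
rewrite exchange_big/= (eq_bigr (fun=> #|` stab tau|)).
  by rewrite sum_nat_const card_ord mulnC.
move=> k _; rewrite exchange_big/= big_seq (eq_bigr (fun=> 1%N)) => [|h ht].
  by rewrite -big_seq sum1_size.
rewrite (big_fsetD1 (h * x k)%g)/= ?coset_rep_mem// eqxx big_seq big1 ?addn0//.
by move=> g; rewrite !inE => /andP[/negbTE ->].
Qed.

Lemma Tn_coset (j : 'I_m1) : Tn n (ltrans (x j)^-1%g tau).
Proof.
apply: Tn_ltrans => //; rewrite invgK -[x j]mul1g; exact: coset_rep_mem stab1.
Qed.

(** If x_i^-1 tau = x_j^-1 tau then x_j x_i^-1 stabilizes tau, so x_i and x_j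
    represent the same coset. *)
Lemma coset_domain_inj (i j : 'I_m1) :
  ltrans (x i)^-1%g tau = ltrans (x j)^-1%g tau -> i = j.
Proof.
move=> E; have hs : (x j * (x i)^-1)%g \in stab tau.
  by rewrite stabP// -ltransM E ltransM mulgV ltrans1.
have jt : x j \in tau by rewrite -[x j]mul1g coset_rep_mem// stab1.
have [k _ uk] := coset_repE jt.
have -> : i = k by apply: uk hs _; rewrite mulgVK.
by apply/esym; apply: uk stab1 _; rewrite mul1g.
Qed.

(** Write g^-1 = h x_j; as h stabilizes tau, g tau = x_j^-1 tau. *)
Lemma Torbit_coset tau' : Torbit tau tau' ->
  exists j : 'I_m1, tau' = ltrans (x j)^-1%g tau.
Proof.
move=> [g /= gt <-]; have [j [h ht gE] _] := coset_repE gt; exists j.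
have -> : g = ((x j)^-1 * h^-1)%g by rewrite -invgM -gE invgK.
by rewrite -ltransM (_ : ltrans h^-1%g tau = tau)// -[in LHS](stab_id ht) ltransM mulVg ltrans1.
Qed.

End cosets.

End orbits_of_domains.

(** * The corner embedding as an average *)

Section corner_map.
Variables (R : realType) (G : groupType) (X : topologicalType).
Variables (s : top_partial_action G X) (n : nat).
Hypotheses (hX : hausdorff_space X) (fin : finite_domains s n).
Let C := cplx R.
Let alpha := C0_partial_action R hX s.
Local Notation D := (dom_at s).
Local Notation fs := (finite_sums alpha).
Implicit Types (a b : C0 R X) (P : set {fset G}).

Lemma near_dom_at P z : P (D z) -> \forall y \near z, P (D y).
Proof. by move=> Pz; apply: filterS (dom_at_near fin z) => y ->. Qed.

Lemma open_dom_at P : open [set z | P (D z)].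
Proof. by rewrite openE => z; exact: near_dom_at. Qed.

Lemma cut_domE P b z :
  C0_cut [set y | P (D y)] b z = if `[< P (D z) >] then b z else 0.
Proof.
rewrite C0_cutE.
- by congr (if _ then _ else _); apply/idP/asboolP => [/set_mem|/mem_set].
- exact: open_dom_at.
- by move=> y Py _; exact: (@near_dom_at (~` P)).
Qed.

Lemma pdomI_Tn tau : Tn n tau -> pdomI alpha tau = C0_ideal [set z | D z = tau].
Proof.
move=> nt; rewrite pdomIE; congr (C0_ideal _); apply/seteqP; split=> z /=.
  by move=> H; apply: dom_at_sub nt _.
by move=> <- g /= /(dom_atP fin).
Qed.

(** To write f as a sum over g of elements of A_{g tau}, each possible value g tau
    of D must be assigned to a single g, since different g may give the same
    set g tau. *)
Lemma orbit_idealE tau : Tn n tau ->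
  orbit_ideal alpha tau = C0_ideal [set z | Torbit tau (D z)].
Proof.
move=> nt; apply/seteqP; split=> [_ [F [d [Fd ->]]] z nz|f fI].
  rewrite C0_sum big_seq big1// => g /Fd[/= gt].
  rewrite pdomI_Tn; last exact: Tn_ltrans.
  by apply=> /= Dz; apply: nz; exists g.
pose c (t : {fset G}) : G := xget 1%g [set g | g^-1%g \in tau /\ ltrans g tau = t].
have cP t : Torbit tau t -> (c t)^-1%g \in tau /\ ltrans (c t) tau = t.
  by move=> [g gt gE]; rewrite /c; case: xgetP => [g' _ //|/(_ g) []].
pose d g := C0_cut [set z | [set t | c t = g /\ Torbit tau t] (D z)] f.
exists [fset (g^-1)%g | g in tau]%fset, d; split=> [_ /imfsetP[g /= gt ->]|].
  split; first by rewrite /= invgK.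
  rewrite pdomI_Tn; last by apply: Tn_ltrans => //; rewrite invgK.
  move=> z nz; rewrite cut_domE; case: asboolP => //= -[cz /cP[_ tz]].
  by exfalso; apply: nz; rewrite /= -[LHS]tz cz.
apply: C0_ext => z; rewrite C0_sum.
have [tz|tz] := pselect (Torbit tau (D z)); last first.
  rewrite (fI _ tz) big1// => g _; rewrite cut_domE; case: asboolP => //= -[_]; exact.
have [ct _] := cP _ tz.
rewrite (big_fsetD1 (c (D z)))/=; last first.
  by apply/imfsetP; exists (c (D z))^-1%g => //; rewrite invgK.
rewrite cut_domE asboolT// big_seq big1 ?addr0// => g.
rewrite in_fsetD1 => /andP[gc _]; rewrite cut_domE; case: asboolP => //= -[cg _].
by rewrite cg eqxx in gc.
Qed.

(** The finite sum representing the value of the corner embedding at an invariant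
    function b for which D takes finitely many values on the support. *)
Definition avg b : G -> C0 R X := locked (fun g =>
  (n%:R : C)^-1 *: C0_cut [set z | [set t : {fset G} | g \in t] (D z)] b).

Lemma avgE b g z : avg b g z = if g \in D z then n%:R^-1 * b z else 0.
Proof.
rewrite /avg -lock C0Z cut_domE /=; case: (boolP (g \in D z)) => gz.
  by rewrite asboolT.
by rewrite asboolF ?mulr0//; exact/negP.
Qed.

Lemma avgB b c : avg b - avg c = avg (b - c).
Proof.
apply/funext => g; apply: C0_ext => z.
apply: (etrans (fs_subE (avg b) (avg c) g z)).
apply: (etrans (congr2 (fun u v => u - v) (avgE b g z) (avgE c g z))).
rewrite [RHS](avgE (b - c) g z); case: ifP => _; last by rewrite subr0.
by rewrite -mulrBr.
Qed.

Lemma fs_avg b (F : {fset {fset G}}) : (forall z, b z != 0 -> D z \in F) ->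
  fs (avg b).
Proof.
move=> bF; split=> [|g].
  apply: (@sub_finite_set _ _ (\bigcup_(t in [set` F]) [set` t])).
    move=> g /= ag; have [z az] : exists z, avg b g z != 0.
      apply: contrapT => H; move/negP: ag; apply; apply/eqP/C0_ext => z.
      by apply/eqP; apply: contrapT => /negP az; apply: H; exists z.
    rewrite avgE in az; exists (D z); last by move: az => /=; case: ifP => //; rewrite eqxx.
    by apply: bF; apply: contra_neq az => ->; rewrite mulr0 if_same.
  by apply: bigcup_finite => // t _; exact: finite_fset.
suff : C0_ideal (tdom s g) (avg b g) by [].
by move=> z gz; rewrite avgE; case: ifP => // /(dom_atP fin).
Qed.

(** At a point z, exactly one j has D z = x_j^-1 tau, and then the sum over k and
    h of delta_{x_j^-1 h x_k} runs once through D z by [sum_cosets]. *)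
Lemma corner_tauE tau x b : Tn n tau -> coset_reps tau x ->
  (forall z, b z != 0 -> Torbit tau (D z)) -> corner_tau alpha tau x b = avg b.
Proof.
move=> nt cx bt; apply/funext => g; apply: C0_ext => z.
pose U i := [set z | [set t | t = ltrans (x i)^-1%g tau] (D z)].
have pE (j : 'I_(stab_index tau)) : component `I_(stab_index tau)
    (fun i => pdomI alpha (ltrans (x i)^-1%g tau)) j b = C0_cut (U j) b.
  apply: component_C0E.
  - exact: ltn_ord.
  - by move=> i ilt; rewrite (pdomI_Tn (Tn_coset nt cx (Ordinal ilt))).
  - by move=> i _; exact: open_dom_at.
  - move=> i k ilt klt [y [/= Uiy Uky]].
    have := @coset_domain_inj _ _ _ _ nt cx (Ordinal ilt) (Ordinal klt).
    by rewrite /= -Uiy -Uky => /(_ erefl) [].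
  - move=> y /bt /(Torbit_coset nt cx)[j' Dy]; exists (val j') => //; exact: ltn_ord.
have inner (j : 'I_(stab_index tau)) :
  \sum_(k < stab_index tau) \sum_(h <- stab tau)
    monomial (C0_cut (U j) b) ((x j)^-1 * h * x k)%g g z =
  if (D z == ltrans (x j)^-1%g tau) && (g \in D z) then b z else 0.
  transitivity (C0_cut (U j) b z *+ (\sum_(k < stab_index tau)
      \sum_(h <- stab tau) (x j * g == h * x k)%g)).
    rewrite -sumrMnr; apply: eq_bigr => k _; rewrite -sumrMnr; apply: eq_bigr => h _.
    rewrite /monomial; have -> : (x j * g == h * x k)%g = (g == (x j)^-1 * h * x k)%g.
      by rewrite -mulgA; apply/eqP/eqP => [<-|->]; rewrite ?mulKg ?mulVKg.
    by case: eqP.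
  rewrite (sum_cosets cx) cut_domE.
  case: (D z =P _) => [E|E].
    rewrite asboolT//= E ltransP invgK; by case: ifP.
  by rewrite asboolF//= mul0rn.
rewrite [LHS]fs_scaleE (card_stab_index nt cx) avgE.
rewrite fs_sumE.
under eq_bigr => j _.
  rewrite fs_sumE pE.
  under eq_bigr => k _ do rewrite fs_sumE.
  rewrite inner; over.
have [bz|bz] := eqVneq (b z) 0.
  by rewrite bz big1 ?mulr0 ?if_same// => j _; rewrite if_same.
have [j Dj] := Torbit_coset nt cx (bt z bz).
rewrite (bigD1 j)//= Dj eqxx/= big1 ?addr0; first by case: ifP; rewrite ?mulr0.
move=> i ij; case: eqP => //= E; move: ij.
by rewrite (coset_domain_inj nt cx E) eqxx.
Qed.

Lemma level_domains a (e : C) : 0 < e ->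
  exists F : {fset {fset G}}, forall z, e <= `|a z| -> D z \in F.
Proof.
move=> e0; have cL := @C0_level_compact _ _ a _ e0.
have [| |F _ LF] := compact_cover_compact cL (D := setT)
  (f := fun t : {fset G} => [set z | [set t] (D z)]).
- by move=> t _; exact: open_dom_at.
- by move=> z _; exists (D z).
by exists F => z /LF[t /= tF ->].
Qed.

Definition invariant b := forall g z, g \in D z -> b (tact s g^-1%g z) = b z.

Lemma invariantB b c : invariant b -> invariant c -> invariant (b - c).
Proof.
move=> ib ic g z gz.
by rewrite -[LHS]/(b (tact s g^-1%g z) - c (tact s g^-1%g z)) ib// ic.
Qed.

Section embedding.
Variables (B : crossed_product alpha).

(** Averages satisfy (avg b)^* avg b = (b^* delta_1) avg(b), so the C*-identity
    gives |avg b|^2 <= |b| |avg b|. *)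
Lemma norm_cp_emb_avg b : invariant b -> fs (avg b) ->
  `|cp_emb B (avg b)| <= `|b|.
Proof.
move=> inv fb.
have n0 (z : X) : n%:R != 0 :> C.
  have [d1 <-] := Tn_dom_at fin z; rewrite pnatr_eq0 cardfs_eq0.
  by apply/eqP => d0; rewrite d0 in_fset0 in d1.
have sq : fs_mul alpha (fs_star alpha (avg b)) (avg b) =
    fs_mul alpha (monomial (cstar b) 1%g) (avg b).
  apply/funext => k; apply: C0_ext => z.
  rewrite [RHS](mul_monomial1E fin _ _ _ fb) (avgE b k z) C0_cstarE.
  rewrite [LHS](fs_mulE fin _ _ _ (fs_star_closed fin fb)) big_seq.
  transitivity (\sum_(g <- D z | g \in D z)
      if k \in D z then (b z)^* * (n%:R^-1 * b z) / n%:R else 0).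
    apply: eq_bigr => g gz; have gz' := gz.
    have gd : tdom s g^-1^-1%g z by rewrite invgK; exact/(dom_atP fin).
    rewrite (fs_starE fin _ _ fb) gz !avgE (dom_at_tact fin gd) !ltransP invgK.
    rewrite mulgV (dom_at1 fin) mulVKg inv//; case: ifP; rewrite ?mulr0//.
    rewrite rmorphM/= fmorphV/= conjC_nat => _.
    by rewrite [RHS]mulrC [RHS]mulrA.
  rewrite -big_seq big_const_seq count_predT iter_addr addr0.
  have [_ ->] := Tn_dom_at fin z; case: ifP; rewrite ?mulr0 ?mul0rn// => _.
  by rewrite -[LHS]mulr_natr divfK// (n0 z).
have := cnormCstar (cp_emb B (avg b)).
rewrite -(cp_emb_star B fb) -(cp_embM B (fs_star_closed fin fb) fb).
rewrite sq (cp_embM B (fs_monomial1 s hX _) fb).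
move=> E; have h := cnormM (cp_emb B (monomial (cstar b) 1%g)) (cp_emb B (avg b)).
rewrite E in h; have h' := norm_cp_emb_monomial1 fin B (cstar b).
rewrite norm_cstar in h'; have h2 := le_trans h (ler_wpM2r (normr_ge0 _) h').
by apply: sqr_le_mul_cancel h2; exact: normr_ge0.
Qed.

Variables (t : set {fset G} -> {fset G}) (x : {fset G} -> nat -> G).
Hypothesis choices : corner_choices n t x.

Definition restr (F : {fset set {fset G}}) a : C0 R X :=
  C0_cut [set z | [set tau | Torbit tau \in F] (D z)] a.

Lemma restrE F a z : restr F a z = if Torbit (D z) \in F then a z else 0.
Proof.
by rewrite /restr cut_domE; congr (if _ then _ else _); apply/asboolP/idP.
Qed.

Lemma invariant_restr F a : invariant a -> invariant (restr F a).
Proof.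
move=> inva g z gz.
have gz' : tdom s g^-1^-1%g z by rewrite invgK; exact/(dom_atP fin).
rewrite !restrE (dom_at_tact fin gz') inva//.
by rewrite (@Torbit_eq _ (D z))//; exists g^-1%g; rewrite //= invgK.
Qed.

Lemma fs_avg_restr F a : fs (avg (restr F a)).
Proof.
have fin_orbit tau : finite_set (Torbit tau).
  apply: finite_image; apply: (@sub_finite_set _ _ [set (g^-1)%g | g in [set` tau]]).
    by move=> g /= gt; exists g^-1%g => //; rewrite invgK.
  by apply: finite_image; exact: finite_fset.
have finF : finite_set (\bigcup_(w in [set` F] `&` Torbits n) w).
  apply: bigcup_finite => [|_ [_ [tau _ <-]]]; last exact: fin_orbit.
  by apply: finite_setIl; exact: finite_fset.
apply: (@fs_avg _ (fset_set (\bigcup_(w in [set` F] `&` Torbits n) w))) => z.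
rewrite restrE; case: ifPn => [DF _|_]; last by rewrite eqxx.
rewrite in_fset_set//; apply/mem_set; exists (Torbit (D z)).
  by split=> //; exists (D z) => //; exact: Tn_dom_at fin z.
by apply: Torbit_refl; exact: dom_at1 fin z.
Qed.

Lemma corner_termE w a :
  (if w \in Torbits n then
     cp_emb B (corner_tau alpha (t w) (x (t w))
       (component (Torbits n) (fun w => orbit_ideal alpha (t w)) w a))
   else 0) = cp_emb B (avg (restr [fset w]%fset a)).
Proof.
have [tP xP] := choices; have [/set_mem wn|wn] := boolP (w \in Torbits n); last first.
  have -> : restr [fset w]%fset a = 0.
    apply: C0_ext => z; rewrite restrE inE; case: eqP => // E.
    exfalso; move/negP: wn; apply; apply/mem_set; rewrite -E.
    by exists (D z) => //; exact: Tn_dom_at fin z.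
  have -> : avg 0 = 0.
    by apply/funext => g; apply: C0_ext => z; rewrite avgE C00 mulr0 if_same.
  by rewrite (cp_emb0 B).
have tE v : Torbits n v -> v = Torbit (t v) /\ Tn n (t v).
  by move=> vn; apply: Torbits_mem vn (tP _ vn).
have DE v z : Torbits n v -> v (D z) -> v = Torbit (D z).
  by move=> vn /(Torbits_mem vn)[].
have -> : component (Torbits n) (fun w => orbit_ideal alpha (t w)) w a =
    C0_cut [set z | w (D z)] a.
  apply: (component_C0E (U := fun w => [set z | w (D z)])) => //.
  - by move=> v vn; have [vE /orbit_idealE ->] := tE v vn; rewrite -vE.
  - by move=> v _; exact: open_dom_at.
  - by move=> v v' vn vn' [z [/= vD vD']]; rewrite (DE v z)// (DE v' z).
  - move=> z _; exists (Torbit (D z)).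
      by exists (D z) => //; exact: Tn_dom_at fin z.
    by apply: Torbit_refl; exact: dom_at1 fin z.
have [wE nw] := tE w wn.
have -> : C0_cut [set z | w (D z)] a = restr [fset w]%fset a.
  apply: C0_ext => z; rewrite cut_domE restrE inE.
  congr (if _ then _ else _); apply/asboolP/eqP => [/(DE _ _ wn) ->//|<-].
  by apply: Torbit_refl; exact: dom_at1 fin z.
rewrite corner_tauE//; first exact: xP.
move=> z; rewrite restrE inE -wE; case: (eqVneq (Torbit (D z)) w) => [E _|_ /eqP//].
by rewrite -E; apply: Torbit_refl; exact: dom_at1 fin z.
Qed.

Lemma cp_emb_sum (I : Type) (r : seq I) (y : I -> G -> C0 R X) :
  (forall i, fs (y i)) -> fs (\sum_(i <- r) y i) /\
  cp_emb B (\sum_(i <- r) y i) = \sum_(i <- r) cp_emb B (y i).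
Proof.
move=> fy; elim: r => [|i r [IH IHE]].
  rewrite !big_nil cp_emb0; split=> //; split=> [|g]; last exact: pdom0.
  by apply: (@sub_finite_set _ _ set0) => // g /=; rewrite eqxx.
rewrite !big_cons; split; first exact: fs_add.
by rewrite cp_embD// IHE.
Qed.

Lemma corner_partial_sumE F a :
  summability.partial_sum (fun w : set {fset G} => if w \in Torbits n then
     cp_emb B (corner_tau alpha (t w) (x (t w))
       (component (Torbits n) (fun w => orbit_ideal alpha (t w)) w a))
   else 0) F = cp_emb B (avg (restr F a)).
Proof.
rewrite /summability.partial_sum.
under eq_bigr do rewrite corner_termE.
rewrite -(big_seq_fsetE _ _ predT (fun w => cp_emb B (avg (restr [fset w]%fset a))))/=.
have [_ <-] := @cp_emb_sum _ F (fun w => avg (restr [fset w]%fset a))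
  (fun w => fs_avg_restr _ _).
congr (cp_emb B _); apply/funext => g; apply: C0_ext => z.
rewrite [LHS]fs_sumE [RHS]avgE restrE.
have out w : w != Torbit (D z) -> avg (restr [fset w]%fset a) g z = 0.
  by move=> wD; rewrite avgE restrE inE eq_sym (negbTE wD) mulr0 if_same.
have [DF|DF] := boolP (Torbit (D z) \in F).
  rewrite (big_fsetD1 (Torbit (D z)))//= big_seq big1 ?addr0 => [|w].
    by rewrite avgE restrE inE eqxx.
  by rewrite in_fsetD1 => /andP[wD _]; exact: out.
rewrite mulr0 if_same big_seq big1// => w wF; apply: out.
by apply: contraNneq DF => <-.
Qed.

(** The partial sums form a Cauchy net: off the orbits meeting the compact set
    where |a| >= e/2, restrictions of a have norm at most e/2, and averaging does
    not increase the norm. *)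
Lemma corner_embedding_cvg a : invariant a ->
  (fun F => cp_emb B (avg (restr F a))) @ (@summability.totally (set {fset G})) -->
  corner_embedding B n t x a.
Proof.
move=> inva.
have E : summability.partial_sum (fun w : set {fset G} => if w \in Torbits n then
     cp_emb B (corner_tau alpha (t w) (x (t w))
       (component (Torbits n) (fun w => orbit_ideal alpha (t w)) w a))
   else 0) = (fun F => cp_emb B (avg (restr F a))).
  by apply/funext => F; rewrite corner_partial_sumE.
rewrite /corner_embedding /summability.sum E.
have FF := @summability.totally_filter (set {fset G}).
suff : cvg ((fun F => cp_emb B (avg (restr F a))) @
  (@summability.totally (set {fset G}))) by [].
apply: cauchy_cvg; apply/cauchyP => e e0.
have e2 : 0 < e / 2 by rewrite divr_gt0.
have [F0 F0P] := level_domains a e2.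
pose F1 : {fset set {fset G}} := [fset Torbit tau | tau in F0]%fset.
exists (cp_emb B (avg (restr F1 a))); exists F1 => // F /= F1F.
rewrite -ball_normE /ball_ /= -(cp_embB B (fs_avg_restr _ _) (fs_avg_restr _ _)).
rewrite avgB; apply: (@le_lt_trans _ _ (e / 2)); last by rewrite gtr_pMr// invf_lt1 ?ltr1n.
apply: (le_trans (norm_cp_emb_avg _ _)).
- by apply: invariantB; exact: invariant_restr.
- by rewrite -avgB; apply: fs_sub; exact: fs_avg_restr.
apply: C0_norm_le => [|z]; first exact: ltW.
rewrite (C0B (restr F1 a) (restr F a) z) !restrE; case: (boolP (Torbit (D z) \in F1)) => [DF|DF].
  by rewrite (fsubsetP F1F)// subrr normr0 ltW.
have az : `|a z| <= e / 2.
  have : e / 2 \is Num.real by exact: gtr0_real.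
  move=> /real_leVge -/(_ _ (normr_real (a z)))/orP[/F0P Lz|//].
  by move/negP: DF; case; apply/imfsetP; exists (D z).
by rewrite sub0r normrN; case: ifP => // _; rewrite normr0 ltW.
Qed.

Lemma corner_embedding_single a w : invariant a ->
  (forall z, a z != 0 -> Torbit (D z) = w) ->
  fs (avg a) /\ corner_embedding B n t x a = cp_emb B (avg a).
Proof.
move=> inva aw; have aE F : w \in F -> restr F a = a.
  move=> wF; apply: C0_ext => z; rewrite restrE.
  by have [->|/aw ->] := eqVneq (a z) 0; rewrite ?if_same// wF.
split; first by rewrite -(aE [fset w]%fset) ?inE//; exact: fs_avg_restr.
have FF := @summability.totally_filter (set {fset G}).
apply: (@cvg_unique _ (@norm_hausdorff _ B)
  ((fun F => cp_emb B (avg (restr F a))) @ (@summability.totally (set {fset G})))).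
  exact: corner_embedding_cvg inva.
rewrite /=; apply: cvg_near_cst; exists [fset w]%fset; first by [].
by move=> F wF; rewrite aE//; apply: (fsubsetP wF); rewrite inE.
Qed.

End embedding.

End corner_map.

(** * The operator norm of a matrix *)

Section row_norm.
Variables (C : numClosedFieldType) (N : nat).
Implicit Types (u v : 'rV[C]_N) (M : 'M[C]_N).
Local Notation "''[' u , v ]" := (@dotmx C N u v) : ring_scope.
Local Notation "''[' u ]" := '[u, u]%R : ring_scope.
Local Open Scope sesquilinear_scope.

Definition row_norm v : C := sqrtC '[v].

Lemma row_norm_ge0 v : 0 <= row_norm v.
Proof. by rewrite sqrtC_ge0; exact: (dnorm_ge0 (@dotmx C N)). Qed.

Lemma row_norm0 : row_norm 0 = 0.
Proof. by rewrite /row_norm (linear0l (@dotmx C N)) sqrtC0. Qed.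

Lemma row_normD u v : row_norm (u + v) <= row_norm u + row_norm v.
Proof. exact: (triangle_lerif (@dotmx C N) u v). Qed.

Lemma row_normZ (k : C) v : row_norm (k *: v) = `|k| * row_norm v.
Proof.
by rewrite /row_norm (dnormZ (@dotmx C N)) sqrtCM ?nnegrE ?exprn_ge0// sqrCK.
Qed.

Lemma row_norm_dot u v : `|'[u, v]| <= row_norm u * row_norm v.
Proof. exact: (CauchySchwarz_sqrt (@dotmx C N) u v). Qed.

Lemma row_norm_eq0 v : row_norm v = 0 -> v = 0.
Proof.
by move=> /eqP; rewrite sqrtC_eq0 (dnorm_eq0 (@dotmx C N)) => /eqP.
Qed.

Lemma row_norm_delta (i : 'I_N) : row_norm (delta_mx 0 i) = 1.
Proof.
rewrite /row_norm dotmxE mxE (bigD1 i)//= big1 ?addr0 => [|j ji].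
  by rewrite !mxE !eqxx /= mul1r rmorph1 sqrtC1.
by rewrite !mxE (negbTE ji) /= mul0r.
Qed.

Lemma row_norm_entry v i : `|v 0 i| <= row_norm v.
Proof.
have := row_norm_dot v (delta_mx 0 i); rewrite row_norm_delta mulr1.
rewrite dotmxE mxE (bigD1 i)//= big1 ?addr0 => [|j ji].
  by rewrite !mxE !eqxx /= rmorph1 mulr1.
by rewrite !mxE (negbTE ji) /= rmorph0 mulr0.
Qed.

Lemma row_norm_adjoint u v M : '[u *m M, v] = '[u, v *m M ^t*].
Proof. by rewrite !dotmxE trmx_mul map_mxM trmxCK mulmxA. Qed.

Lemma row_norm_mul_bound M v : row_norm v <= 1 ->
  row_norm (v *m M) <= \sum_(i < N) row_norm (row i M).
Proof.
move=> v1; rewrite mulmx_sum_row.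
apply: (@le_trans _ _ (\sum_i row_norm (v 0 i *: row i M))).
  elim/big_ind2 : _ => [|u r u' r' ur ur'|//]; first by rewrite row_norm0.
  by apply: (le_trans (row_normD _ _)); exact: lerD.
apply: ler_sum => i _; rewrite row_normZ ler_piMl ?row_norm_ge0//.
exact: le_trans (row_norm_entry v i) v1.
Qed.

(** Stated as a least upper bound so that the C*-identity can be proved over
    any numClosedFieldType, where suprema need not exist. *)
Definition is_op_norm (op : 'M[C]_N -> C) := forall M,
  [/\ 0 <= op M, (forall v, row_norm v <= 1 -> row_norm (v *m M) <= op M) &
      forall e, 0 <= e -> (forall v, row_norm v <= 1 -> row_norm (v *m M) <= e) ->
        op M <= e].

Variable op : 'M[C]_N -> C.
Hypothesis opP : is_op_norm op.

Lemma op_norm_ge0 M : 0 <= op M. Proof. by have [] := opP M. Qed.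

Lemma op_norm_ub M v : row_norm v <= 1 -> row_norm (v *m M) <= op M.
Proof. by have [_ + _] := opP M; apply. Qed.

Lemma op_norm_le M e : 0 <= e ->
  (forall v, row_norm v <= 1 -> row_norm (v *m M) <= e) -> op M <= e.
Proof. by have [_ _] := opP M; apply. Qed.

Lemma row_normM M v : row_norm (v *m M) <= op M * row_norm v.
Proof.
have [v0|v0] := eqVneq (row_norm v) 0.
  by rewrite (row_norm_eq0 v0) mul0mx row_norm0 mulr0.
have vp : 0 < row_norm v by rewrite lt_def v0 row_norm_ge0.
have := @op_norm_ub M ((row_norm v)^-1 *: v).
rewrite -scalemxAl !row_normZ normfV ger0_norm ?row_norm_ge0// mulVf// => /(_ (lexx _)).
by rewrite mulrC ler_pdivrMr.
Qed.

Lemma op_normD M M' : op (M + M') <= op M + op M'.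
Proof.
apply: op_norm_le => [|v v1]; first by rewrite addr_ge0 ?op_norm_ge0.
by rewrite mulmxDr (le_trans (row_normD _ _))// lerD// op_norm_ub.
Qed.

Lemma op_normZ (k : C) M : op (k *: M) = `|k| * op M.
Proof.
apply/eqP; rewrite eq_le; apply/andP; split.
  apply: op_norm_le => [|v v1]; first by rewrite mulr_ge0// op_norm_ge0.
  by rewrite -scalemxAr row_normZ ler_wpM2l// op_norm_ub.
have [->|k0] := eqVneq k 0; first by rewrite normr0 mul0r op_norm_ge0.
have nk : 0 < `|k| by rewrite normr_gt0.
rewrite mulrC -ler_pdivlMr//; apply: op_norm_le => [|v v1].
  by rewrite divr_ge0// op_norm_ge0.
by rewrite ler_pdivlMr// mulrC -row_normZ scalemxAr op_norm_ub.
Qed.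

Lemma op_normM M M' : op (M *m M') <= op M * op M'.
Proof.
apply: op_norm_le => [|v v1]; first by rewrite mulr_ge0 ?op_norm_ge0.
rewrite mulmxA mulrC; apply: (le_trans (row_normM _ _)).
by rewrite ler_wpM2l ?op_norm_ge0// op_norm_ub.
Qed.

Lemma op_norm_entry M i j : `|M i j| <= op M.
Proof.
have -> : M i j = ((delta_mx 0 i : 'rV_N) *m M) 0 j by rewrite -rowE mxE.
by rewrite (le_trans (row_norm_entry _ _))// op_norm_ub// row_norm_delta.
Qed.

Let op_norm_sqr M : op M ^+ 2 <= op (M *m M ^t*).
Proof.
rewrite -[leRHS]sqrtCK lerXn2r ?nnegrE ?sqrtC_ge0 ?op_norm_ge0//.
apply: op_norm_le => [|v v1]; first by rewrite sqrtC_ge0 op_norm_ge0.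
rewrite /row_norm ler_sqrtC ?nnegrE ?op_norm_ge0//; last exact: (dnorm_ge0 (@dotmx C N)).
rewrite -[leLHS]ger0_norm; last exact: (dnorm_ge0 (@dotmx C N)).
rewrite row_norm_adjoint -mulmxA; apply: (le_trans (row_norm_dot _ _)).
rewrite -[leRHS]mul1r ler_pM ?row_norm_ge0//; exact: op_norm_ub.
Qed.

(** |v M|^2 = <v M M', v> yields |M|^2 <= |M M'| <= |M| |M'|, whence
    |M| <= |M'|, and equality by symmetry; M' is the adjoint. *)
Lemma op_norm_star M : op (M ^t* *m M) = op M ^+ 2.
Proof.
have adj A : op A <= op (A ^t*).
  apply: sqr_le_mul_cancel; rewrite ?op_norm_ge0//.
  by rewrite mulrC (le_trans (op_norm_sqr A))// op_normM.
have adjE : op (M ^t*) = op M.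
  by have := adj (M ^t*); rewrite trmxCK => h; apply/eqP; rewrite eq_le h adj.
apply/eqP; rewrite eq_le; apply/andP; split.
  by rewrite (le_trans (op_normM _ _))// adjE expr2.
by rewrite -adjE (le_trans (op_norm_sqr _))// trmxCK.
Qed.

End row_norm.

Lemma op_norm_exists (R : realType) (N : nat) :
  exists op : 'M[cplx R]_N -> cplx R, is_op_norm op.
Proof.
pose vals (M : 'M[cplx R]_N) := [set cabs (row_norm (v *m M)) | v in [set v | row_norm v <= 1]].
have ub M : has_ubound (vals M).
  exists (cabs (\sum_(i < N) row_norm (row i M))) => _ [v /= v1 <-].
  rewrite -lecR !cabsE ger0_norm; last exact: row_norm_ge0.
  apply: (le_trans (row_norm_mul_bound M v1)); apply: real_ler_norm.
  by apply: ger0_real; apply: sumr_ge0 => i _; exact: row_norm_ge0.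
have ubP M v : row_norm v <= 1 -> row_norm (v *m M) <= ((sup (vals M))%:C)%C.
  move=> v1; rewrite -[leLHS]ger0_norm; last exact: row_norm_ge0.
  by rewrite -cabsE lecR; apply: ub_le_sup; [exact: ub|exists v].
exists (fun M => ((sup (vals M))%:C)%C) => M; split.
- apply: le_trans (ubP M 0 _); first exact: row_norm_ge0.
  by rewrite row_norm0; exact: ler01.
- exact: ubP.
- move=> e e0 Me; have [r r0 er] := cplx_ge0_real e0; rewrite er lecR.
  apply: ge_sup.
    by exists (cabs (row_norm (0 *m M))), 0 => //; rewrite /= row_norm0; exact: ler01.
  move=> _ [v /= v1 <-]; rewrite -lecR -er cabsE ger0_norm; last exact: row_norm_ge0.
  exact: Me.
Qed.

(** * Free actions have full corners *)

Section free_implies_full.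
Variables (R : realType) (G : groupType) (X : topologicalType).
Variables (s : top_partial_action G X) (n : nat).
Hypotheses (hX : hausdorff_space X) (lcX : locally_compact [set: X]).
Hypothesis fin : finite_domains s n.
Let C := cplx R.
Let alpha := C0_partial_action R hX s.
Local Notation D := (dom_at s).
Local Notation proj := (orbit_proj s).
Local Notation fs := (finite_sums alpha).
Variables (B : crossed_product alpha).
Variables (t : set {fset G} -> {fset G}) (x : {fset G} -> nat -> G).
Hypothesis choices : corner_choices n t x.

Lemma fixed_invariant f : fixed_algebra alpha f -> invariant s f.
Proof.
move=> /(fixed_algebraP s hX lcX) inv g z /(dom_atP fin) gz.
by apply: inv; rewrite invgK.
Qed.

Lemma Torbit_proj y z : proj y = proj z -> Torbit (D z) = Torbit (D y).
Proof.
move=> /(orbitP fin)[g gy ->]; have /(dom_atP fin) gy' := gy.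
rewrite (dom_at_tact fin) ?invgK//; apply: Torbit_eq.
by exists g^-1%g; rewrite //= invgK.
Qed.

Lemma monomialD (f h : C0 R X) (g : G) : monomial (f + h) g = monomial f g + monomial h g.
Proof.
apply/funext => k; rewrite -[RHS]/(monomial f g k + monomial h g k) /monomial.
by case: eqP; rewrite ?addr0.
Qed.

Lemma monomialZ (c : C) (f : C0 R X) (g : G) : monomial (c *: f) g = c *: monomial f g.
Proof.
apply/funext => k; rewrite -[RHS]/(c *: monomial f g k) /monomial.
by case: eqP; rewrite ?scaler0.
Qed.

(** Closedness uses that f |-> f delta_g is contractive, and absorption of
    products that (h delta_1) (f delta_g) = h f delta_g. *)
Lemma monomial_ideal (I : set B) g : closed_ideal I ->
  closed_ideal [set f : C0 R X | C0_ideal (tdom s g) f /\ I (cp_emb B (monomial f g))].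
Proof.
move=> [clI I0 ID IZ IM].
have [clg _ gD gZ gM] := @C0_ideal_closed_ideal R X (tdom s g).
split.
- move=> f clf; have fg : C0_ideal (tdom s g) f.
    by apply: clg; apply: closureS clf => h [].
  split=> //; apply: clI; apply/closure_normP => e e0.
  have [j [jg Ij] fj] := (closure_normP _ _).1 clf e e0.
  exists (cp_emb B (monomial j g)) => //.
  rewrite -(cp_embB B (fs_monomial hX fg) (fs_monomial hX jg)).
  have -> : monomial f g - monomial j g = monomial (f - j) g.
    by rewrite -scaleN1r -monomialZ -monomialD scaleN1r.
  apply: le_lt_trans fj; apply: norm_cp_emb_monomial fin _ _ _ _.
  by rewrite -scaleN1r; apply: gD => //; exact: gZ.
- split=> //; have -> : monomial 0 g = 0 :> (G -> C0 R X).
    by apply/funext => k; rewrite /monomial; case: eqP.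
  by rewrite cp_emb0.
- move=> f h [fg If] [hg Ih]; split; first exact: gD.
  rewrite monomialD (cp_embD B (fs_monomial hX fg) (fs_monomial hX hg)).
  exact: ID.
- move=> c f [fg If]; split; first exact: gZ.
  by rewrite monomialZ (cp_embZ B c (fs_monomial hX fg)); exact: IZ.
- move=> f h [fg If].
  have fh : f ** h = h ** f by apply: C0_ext => z; rewrite !C0_cmulE mulrC.
  rewrite fh; suff : C0_ideal (tdom s g) (h ** f) /\ I (cp_emb B (monomial (h ** f) g)) by [].
  split; first by have [] := gM f h fg.
  have -> : monomial (h ** f) g = fs_mul alpha (monomial h 1%g) (monomial f g).
    apply/funext => k; apply: C0_ext => z.
    rewrite (mul_monomial1E fin _ _ _ (fs_monomial hX fg)) /monomial.
    by case: eqP => //; rewrite ?C0_cmulE ?C00 ?mulr0.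
  rewrite (cp_embM B (fs_monomial1 s hX h) (fs_monomial hX fg)).
  by have [] := IM _ (cp_emb B (monomial h 1%g)) If.
Qed.

(** Pull back a bump function of the orbit space supported on the open image of
    the set of points with the same D-value as x0. *)
Lemma invariant_bump x0 : exists a : C0 R X,
  [/\ fixed_algebra alpha a, a x0 = 1 &
      forall z, a z != 0 -> Torbit (D z) = Torbit (D x0)].
Proof.
have hY := orbit_space_hausdorff fin hX.
have lcY := orbit_space_locally_compact fin hX lcX.
have [q q1 qI] := @C0_bump R _ hY lcY _ _ (orbit_proj_nbhs fin (dom_at_near fin x0)).
exists (pullback hX lcX fin q); split; first exact: pullback_fixed.
  by [].
move=> z qz; have [y Dy yz] : (proj @` [set y | D y = D x0]) (proj z).
  by apply: contrapT => /qI qz0; move/eqP: qz; exact.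
by rewrite (Torbit_proj yz) Dy.
Qed.

(** Freeness makes the points s_{l^-1} x0 with l in D x0 distinct, so that
    s_{g^-1} x0 can be separated from the finitely many others. *)
Lemma free_separation g x0 : free_action s -> g \in D x0 ->
  exists V : set X, nbhs (tact s g^-1%g x0) V /\
    \forall y \near x0, D y = D x0 /\
      forall l, l \in D x0 -> l != g -> ~ V (tact s l^-1%g y).
Proof.
move=> free gx; have hX' := hX; rewrite open_hausdorff in hX'.
(* if s_{l^-1} x0 = s_{g^-1} x0 then g^-1 l fixes this point *)
have neq l : l \in D x0 -> l != g -> tact s g^-1%g x0 != tact s l^-1%g x0.
  move=> lx /eqP lg; apply/eqP => E; apply: lg.
  have /(dom_atP fin) gx' := gx; have /(dom_atP fin) lx' := lx.
  have lV : tdom s l^-1%g (tact s l^-1%g x0) by exact: tactV_dom.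
  have gl : tdom s g^-1^-1%g (tact s l (tact s l^-1%g x0)) by rewrite tactVK ?invgK.
  have [d1 E1] := tactM lV gl.
  have /(free _ _ d1) E2 : tact s (g^-1 * l)%g (tact s l^-1%g x0) = tact s l^-1%g x0.
    by rewrite E1 tactVK.
  by rewrite -[l](mulVKg g) E2 mulg1.
have /choice[W WP] : forall l, exists UV : set X * set X, l \in D x0 -> l != g ->
    [/\ nbhs (tact s g^-1%g x0) UV.1, nbhs (tact s l^-1%g x0) UV.2 &
        UV.1 `&` UV.2 = set0].
  move=> l; have [lx|lx] := boolP (l \in D x0); last by exists (set0, set0).
  have [lg|lg] := boolP (l != g); last by exists (set0, set0).
  have /hX'[[U V] /= [Ux Vy] [oU oV /eqP UV]] := neq l lx lg.
  by exists (U, V) => _ _; split=> //; apply: open_nbhs_nbhs; split=> //; exact: set_mem.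
exists [set y | forall l, l \in D x0 -> l != g -> (W l).1 y]; split.
  apply: near_in_seq => l lx; have [->|lg] := eqVneq l g; first by apply: nearW.
  by have [U1 _ _] := WP l lx lg; apply: filterS U1 => y ? _.
apply: filterI; first exact: dom_at_near fin x0.
have : \forall y \near x0, forall l, l \in D x0 -> l != g -> (W l).2 (tact s l^-1%g y).
  apply: near_in_seq => l lx; have [->|lg] := eqVneq l g; first by apply: nearW.
  have [_ U2 _] := WP l lx lg.
  have lx' : tdom s l^-1^-1%g x0 by rewrite invgK; exact/(dom_atP fin).
  have nU : \forall y \near x0, (W l).2 (tact s l^-1%g y) := tact_near lx' U2.
  by apply: filterS nU => y ? _.
apply: filterS => y H l lx lg VW; have [_ _ UV] := WP l lx lg.
suff : set0 (tact s l^-1%g y) by [].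
by rewrite -UV; split; [exact: VW|exact: H].
Qed.

Lemma free_full_range : free_action s -> full_range (corner_embedding B n t x).
Proof.
move=> free I idI cI; have [clI I0 ID IZ IM] := idI.
have mono g f : C0_ideal (tdom s g) f -> I (cp_emb B (monomial f g)).
  move=> fg; suff [] : [set f : C0 R X | C0_ideal (tdom s g) f /\
      I (cp_emb B (monomial f g))] f by [].
  apply: (closed_ideal_C0P (monomial_ideal g idI)) => x0 fx.
  have gx : g \in D x0.
    by apply/(dom_atP fin); apply: contrapT => /fg fx0; move/eqP: fx; exact.
  have [V [nV nN]] := free_separation free gx.
  have [a [afix ax aw]] := invariant_bump x0.
  have inva := fixed_invariant afix.
  have [fsa cE] := corner_embedding_single fin B choices inva aw.
  have [e ex eN] := @C0_bump R _ hX lcX _ _ nN.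
  have [e' ex' eV] := @C0_bump R _ hX lcX _ _ nV.
  pose y1 := fs_mul alpha (monomial e 1%g) (avg s n a).
  have fs1 : fs y1 by exact: fs_mul_closed fin _ _ (fs_monomial1 s hX e) fsa.
  pose y2 := fs_mul alpha y1 (monomial e' 1%g).
  have fs2 : fs y2 by exact: fs_mul_closed fin _ _ fs1 (fs_monomial1 s hX e').
  have y2E k z : y2 k z =
      if k \in D z then e z * (n%:R^-1 * a z) * e' (tact s k^-1%g z) else 0.
    rewrite (mul_monomialrE fin _ _ _ fs1); case: ifP => // kz.
    by rewrite (mul_monomial1E fin _ _ _ fsa) (avgE fin a k z) kz.
  (* the left bump keeps z near x0 and the right bump keeps s_{k^-1} z near
     s_{g^-1} x0; together they leave only k = g *)
  have y2g : y2 = monomial (y2 g) g.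
    apply/funext => k; rewrite /monomial; case: eqP => [->//|/eqP kg].
    apply: C0_ext => z; rewrite y2E C00; case: ifP => // kz.
    have [[Dz Hz]|/eN ->] := pselect (D z = D x0 /\
      forall l, l \in D x0 -> l != g -> ~ V (tact s l^-1%g z)); last by rewrite !mul0r.
    by rewrite (eV (tact s k^-1%g z)) ?mulr0//; apply: Hz; rewrite // -Dz.
  exists (y2 g); last first.
    rewrite y2E gx ex ex' ax !mulr1 mul1r invr_eq0 pnatr_eq0.
    have [d1 <-] := Tn_dom_at fin x0; rewrite cardfs_eq0.
    by apply/eqP => d0; rewrite d0 in_fset0 in d1.
  split; first by have [_] := fs2; exact.
  rewrite -y2g (cp_embM B fs1 (fs_monomial1 s hX e')).
  apply: (IM _ _ _).2; rewrite (cp_embM B (fs_monomial1 s hX e) fsa).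
  by apply: (IM _ _ _).1; apply: cI; exists a.
have all y : fs y -> I (cp_emb B y).
  move=> [yfin yI].
  have -> : y = \sum_(g <- fset_set [set g | y g != 0]) monomial (y g) g.
    apply/funext => k; apply: C0_ext => z; rewrite [RHS]fs_sumE.
    have [kF|kF] := boolP (k \in fset_set [set g | y g != 0]).
      rewrite (big_fsetD1 k)//= big_seq big1 ?addr0; first by rewrite /monomial eqxx.
      by move=> g; rewrite !inE /monomial eq_sym => /andP[/negbTE ->].
    have -> : y k = 0.
      move: kF; rewrite in_fset_set// notin_setE /= => /negP.
      by rewrite negbK => /eqP.
    rewrite big_seq big1// => g gF; rewrite /monomial; case: eqP => // E.
    by move: kF; rewrite E gF.
  have [_ ->] := cp_emb_sum B (fset_set [set g | y g != 0])
    (fun g => fs_monomial hX (yI g)).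
  by elim/big_ind : _ => // g _; apply: mono; exact: yI.
apply/seteqP; split=> // b _; apply: clI.
have : closure (cp_emb B @` fs) b by rewrite cp_emb_dense.
by apply: closureS => _ [y fy <-]; exact: all.
Qed.

End free_implies_full.

(** * Isotropy yields a proper ideal containing the corner *)

Section orbit_representation.
Variables (R : realType) (G : groupType) (X : topologicalType).
Variables (s : top_partial_action G X) (n : nat).
Hypotheses (hX : hausdorff_space X) (lcX : locally_compact [set: X]).
Hypothesis fin : finite_domains s n.
Let C := cplx R.
Let alpha := C0_partial_action R hX s.
Local Notation D := (dom_at s).
Local Notation fs := (finite_sums alpha).
Local Open Scope sesquilinear_scope.
Variable x0 : X.
Local Notation N := #|` D x0|.
Implicit Types (y : G -> C0 R X).

Let el (i : 'I_N) : G := nth 1%g (D x0) i.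
Let pt (i : 'I_N) : X := tact s (el i)^-1%g x0.

Lemma el_in i : el i \in D x0. Proof. exact: mem_nth. Qed.

Lemma el_inj : injective el.
Proof.
move=> i j /eqP; rewrite nth_uniq ?ltn_ord ?fset_uniq// => /eqP; exact: val_inj.
Qed.

Lemma el_ex g : g \in D x0 -> exists i, el i = g.
Proof.
move=> gx; have ilt : (index g (D x0) < N)%N by rewrite index_mem.
by exists (Ordinal ilt); rewrite /el /= nth_index.
Qed.

Lemma sum_el (F : G -> C) : \sum_(g <- D x0) F g = \sum_i F (el i).
Proof. by rewrite (big_nth 1%g) big_mkord. Qed.

Lemma dom_at_pt i : D (pt i) = ltrans (el i)^-1%g (D x0).
Proof. by apply: (dom_at_tact fin); rewrite invgK; apply/(dom_atP fin); exact: el_in. Qed.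

Lemma pt_move i g : g \in D x0 ->
  tact s ((el i)^-1 * g)^-1%g (pt i) = tact s g^-1%g x0.
Proof.
move=> gx; have /(dom_atP fin) ix := el_in i; have ix' : tdom s (el i)^-1^-1%g x0 by rewrite invgK.
have := @tactM _ _ s ((el i)^-1 * g)^-1%g (el i)^-1%g x0 ix'.
rewrite invgK => /(_ _)[|_ <-].
  by apply/(dom_atP fin); rewrite dom_at_pt ltransP mulKg.
by rewrite invgM invgK mulgK.
Qed.

(** The action of the finite sum y on the l^2 space of the groupoid arrows with
    source x0. The arrow from x0 to s_{u^-1} x0 is indexed by u in D x0, whose
    i-th element is [el i]. *)
Definition orbit_rep y : 'M[C]_N :=
  \matrix_(i, j) y ((el i)^-1 * el j)%g (pt i).

Lemma orbit_repD y z : orbit_rep (y + z) = orbit_rep y + orbit_rep z.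
Proof. by apply/matrixP => i j; rewrite !mxE. Qed.

Lemma orbit_repZ (c : C) y : orbit_rep (c *: y) = c *: orbit_rep y.
Proof. by apply/matrixP => i j; rewrite !mxE. Qed.

Lemma orbit_repM y z : fs y ->
  orbit_rep (fs_mul alpha y z) = orbit_rep y *m orbit_rep z.
Proof.
move=> fy; apply/matrixP => i j; rewrite !mxE (fs_mulE fin _ _ _ fy) dom_at_pt.
rewrite /ltrans big_imfset /=; last by move=> ? ? _ _; exact: mulgI.
rewrite sum_el; apply: eq_bigr => k _; rewrite !mxE.
rewrite (pt_move _ (el_in k)); congr (_ * z _ _).
by rewrite invgM invgK -mulgA mulVKg.
Qed.

Lemma orbit_rep_star y : fs y ->
  orbit_rep (fs_star alpha y) = (orbit_rep y) ^t*.
Proof.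
move=> fy; apply/matrixP => i j; rewrite !mxE (fs_starE fin _ _ fy) dom_at_pt.
rewrite ltransP mulKg el_in (pt_move _ (el_in j)).
by rewrite invgM invgK.
Qed.

(** The norm of B dominates the C*-seminorm given by the operator norm of the
    representation, and this dominates each matrix entry. *)
Lemma coefficient_bound (B : crossed_product alpha) y i j : fs y ->
  `|y ((el i)^-1 * el j)%g (pt i)| <= `|cp_emb B y|.
Proof.
move=> fy; have [op opP] := op_norm_exists R N.
have := @cp_emb_max _ _ _ _ B (fun y => op (orbit_rep y)).
move=> /(_ _ y fy) H; apply: le_trans (H _).
  have := op_norm_entry opP (orbit_rep y) i j; rewrite mxE; exact.
move=> u v fu fv; split.
- exact: op_norm_ge0 opP _.
- by rewrite orbit_repD; exact: op_normD opP _ _.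
- by move=> k; rewrite orbit_repZ; exact: op_normZ opP _ _.
- by rewrite (orbit_repM _ fu); exact: op_normM opP _ _.
- rewrite (orbit_repM _ (fs_star_closed fin fu)) (orbit_rep_star fu).
  exact: op_norm_star opP _.
Qed.

Section isotropy.
Variables (B : crossed_product alpha) (g : G).
Hypotheses (gx : tdom s g^-1%g x0) (gfix : tact s g x0 = x0).

Lemma dom_at_fix h : (h \in D x0) = ((g * h)%g \in D x0).
Proof.
have := dom_at_tact fin gx; rewrite gfix => E.
by rewrite [in RHS]E ltransP mulKg.
Qed.

Lemma fix_mem : g \in D x0.
Proof. by have := dom_at_fix 1%g; rewrite mulg1 (dom_at1 fin). Qed.

(** The permutation matrix of left translation by g on D x0, which is the right
    action of the isotropy group on the arrows. *)
Definition isotropy_mx : 'M[C]_N := \matrix_(i, j) (el j == g * el i)%g%:R.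

Lemma mul_isotropy (M : 'M[C]_N) i j m : el m = (g^-1 * el j)%g ->
  (M *m isotropy_mx) i j = M i m.
Proof.
move=> mE; rewrite mxE (bigD1 m)//= big1 ?addr0 => [|k km].
  by rewrite mxE mE mulVKg eqxx mulr1.
rewrite mxE; case: eqP => [E|_]; last by rewrite mulr0.
by case/negP: km; apply/eqP/el_inj; rewrite mE E mulKg.
Qed.

Lemma isotropy_mul (M : 'M[C]_N) i j m : el m = (g * el i)%g ->
  (isotropy_mx *m M) i j = M m j.
Proof.
move=> mE; rewrite mxE (bigD1 m)//= big1 ?addr0 => [|k km].
  by rewrite mxE mE eqxx mul1r.
rewrite mxE; case: eqP => [E|_]; last by rewrite mul0r.
by case/negP: km; apply/eqP/el_inj; rewrite mE E.
Qed.

Lemma ex_mul i : exists m, el m = (g * el i)%g.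
Proof. by apply: el_ex; rewrite -dom_at_fix el_in. Qed.

Lemma ex_mulV i : exists m, el m = (g^-1 * el i)%g.
Proof. by apply: el_ex; rewrite dom_at_fix mulVKg el_in. Qed.

(** Both products have at (i, j) the coefficient of y at u^-1 g^-1 v evaluated at
    s_{u^-1} x0, where u and v are the i-th and j-th elements of D x0: g fixes
    x0, hence s_{(g u)^-1} x0 = s_{u^-1} x0. *)
Lemma isotropy_comm y : orbit_rep y *m isotropy_mx = isotropy_mx *m orbit_rep y.
Proof.
apply/matrixP => i j; have [m mE] := ex_mulV j; have [k kE] := ex_mul i.
rewrite (mul_isotropy _ _ mE) (isotropy_mul _ _ kE) !mxE mE kE.
rewrite invgM mulgA; congr (y _ _); rewrite /pt kE.
have ix : (g * el i)%g \in D x0 by rewrite -dom_at_fix el_in.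
have /(dom_atP fin) ix' := el_in i.
have := @tactM _ _ s (el i)^-1%g g^-1%g x0.
have gx' : tdom s g^-1^-1%g x0 by rewrite invgK; apply/(dom_atP fin); exact: fix_mem.
have gfix' : tact s g^-1%g x0 = x0 by rewrite -{1}gfix tactK.
rewrite gfix' !invgK => /(_ _ ix')[|_].
  by apply/(dom_atP fin); exact: fix_mem.
by rewrite -invgM.
Qed.

Definition isotropy_ideal : set B :=
  closure (cp_emb B @` [set y | fs y /\ orbit_rep y *m isotropy_mx = orbit_rep y]).

Lemma isotropy_ideal_closed : closed_ideal isotropy_ideal.
Proof.
have KM y z : orbit_rep y *m isotropy_mx = orbit_rep y -> fs y -> fs z ->
    orbit_rep (fs_mul alpha z y) *m isotropy_mx = orbit_rep (fs_mul alpha z y) /\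
    orbit_rep (fs_mul alpha y z) *m isotropy_mx = orbit_rep (fs_mul alpha y z).
  move=> Ey fy fz; rewrite (orbit_repM _ fz) (orbit_repM _ fy) -!mulmxA Ey.
  by rewrite isotropy_comm [orbit_rep y *m (_ *m _)]mulmxA Ey.
apply: (closure_closed_ideal (cp_emb_dense B)).
- exists 0; last exact: cp_emb0; split.
    split=> [|k]; last exact: pdom0.
    by apply: (@sub_finite_set _ _ set0) => // k /=; rewrite eqxx.
  have -> : orbit_rep 0 = 0 by apply/matrixP => i j; rewrite !mxE.
  by rewrite mul0mx.
- move=> _ _ [y [fy Ey] <-] [z [fz Ez] <-]; rewrite -(cp_embD B fy fz).
  exists (y + z) => //; split; first exact: fs_add.
  by rewrite orbit_repD mulmxDl Ey Ez.
- move=> c _ [y [fy Ey] <-]; rewrite -(cp_embZ B c fy).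
  exists (c *: y) => //; split; first exact: fs_scale.
  by rewrite orbit_repZ -scalemxAl Ey.
- move=> _ _ [y [fy Ey] <-] [z fz <-]; have [E1 E2] := KM y z Ey fy fz.
  rewrite -(cp_embM B fz fy) -(cp_embM B fy fz); split.
    by exists (fs_mul alpha z y) => //; split=> //; exact: fs_mul_closed fin _ _ fz fy.
  by exists (fs_mul alpha y z) => //; split=> //; exact: fs_mul_closed fin _ _ fy fz.
Qed.

(** On matrices absorbing the permutation, the entries at (1, 1) and (1, g)
    agree. For f delta_1 they are f x0 = 1 and 0, so the coefficient bound keeps
    f delta_1 at distance at least 1/2 from all of them. *)
Lemma isotropy_ideal_proper : g != 1%g ->
  isotropy_ideal <> setT.
Proof.
move=> g1 IT; have [f fx _] := @C0_bump R _ hX lcX setT x0 (@filterT _ _ _).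
have : isotropy_ideal (cp_emb B (monomial f 1%g)) by rewrite IT.
have h2 : 0 < 2^-1 :> C by rewrite invr_gt0.
move=> /closure_normP/(_ _ h2)[_ [y [fy yT] <-]].
have ff := fs_monomial1 s hX f.
rewrite -(cp_embB B ff fy); have fd := fs_sub ff fy.
have [i iE] := el_ex (dom_at1 fin x0); have [j jE] := el_ex fix_mem.
have pti : pt i = x0 by rewrite /pt iE invg1 tact1.
have yE : y 1%g x0 = y g x0.
  have := congr1 (fun M : 'M[C]_N => M i j) yT.
  rewrite (@mul_isotropy _ i j i); last by rewrite iE jE mulVg.
  by rewrite !mxE pti iE jE invg1 !mul1g.
have ci := coefficient_bound B i i fd; have cj := coefficient_bound B i j fd.
rewrite pti iE invg1 mul1g in ci; rewrite pti iE jE invg1 mul1g in cj.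
rewrite [X in `|X|]fs_subE /monomial eqxx fx in ci.
rewrite [X in `|X|]fs_subE /monomial (negbTE g1) -yE C00 sub0r normrN in cj.
move=> lt2; have : 1 < 1 :> C.
  rewrite -{1}[1 in X in X < _]normr1 -{1}[1](subrK (y 1%g x0)).
  apply: (le_lt_trans (ler_normD _ _)).
  rewrite [ltRHS](splitr 1) mul1r; apply: ltrD.
    exact: le_lt_trans ci lt2.
  exact: le_lt_trans cj lt2.
by rewrite ltxx.
Qed.

(** All entries of the matrix are b x0 / n, and a permutation of the columns does
    not change a constant matrix. *)
Lemma avg_isotropy b : invariant s b -> orbit_rep (avg s n b) *m isotropy_mx =
  orbit_rep (avg s n b).
Proof.
move=> inv; have E i j : orbit_rep (avg s n b) i j = n%:R^-1 * b x0.
  rewrite mxE (avgE fin b _ (pt i)) dom_at_pt ltransP mulKg el_in.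
  by rewrite inv// el_in.
by apply/matrixP => i j; have [m mE] := ex_mulV j; rewrite (mul_isotropy _ _ mE) !E.
Qed.

End isotropy.

End orbit_representation.

Section full_implies_free.
Variables (R : realType) (G : groupType) (X : topologicalType).
Variables (s : top_partial_action G X) (n : nat).
Hypotheses (hX : hausdorff_space X) (lcX : locally_compact [set: X]).
Hypothesis fin : finite_domains s n.
Let alpha := C0_partial_action R hX s.
Variables (B : crossed_product alpha).
Variables (t : set {fset G} -> {fset G}) (x : {fset G} -> nat -> G).
Hypothesis choices : corner_choices n t x.

Lemma full_range_free : full_range (corner_embedding B n t x) -> free_action s.
Proof.
move=> full g x0 gx gfix; apply/eqP; apply: contrapT => /negP g1.
apply: (isotropy_ideal_proper lcX fin gx gfix (B := B) g1).
apply: full; first exact: isotropy_ideal_closed.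
move=> _ [a afix <-]; have inva := fixed_invariant lcX fin afix.
have FF := @summability.totally_filter (set {fset G}).
have [clI _ _ _ _] := isotropy_ideal_closed fin B gx gfix.
have cvgc := corner_embedding_cvg fin (B := B) choices inva.
apply: (@closed_cvg _ _ _ FF _ _ clI _ _ cvgc).
apply: nearW => F; apply: subset_closure; exists (avg s n (restr s F a)) => //.
split; first exact: fs_avg_restr.
apply: avg_isotropy => //; exact: invariant_restr.
Qed.

End full_implies_free.

Theorem theorem5p5 (R : realType) (G : groupType) (X : topologicalType)
    (hX : hausdorff_space X) (lcX : locally_compact [set: X])
    (s : top_partial_action G X)
    (hs : exists n, decomposition_property (C0_partial_action R hX s) n) :
  [/\ hausdorff_space (orbit_space s),
      locally_compact [set: orbit_space s] &
      exists Phi : C0 R X -> C0 R (orbit_space s),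
        star_iso_on (fixed_algebra (C0_partial_action R hX s)) setT Phi /\
        (forall f, fixed_algebra (C0_partial_action R hX s) f ->
          forall x, Phi f (orbit_proj s x) = f x)] /\
  (forall (B : crossed_product (C0_partial_action R hX s)) (n : nat)
      (t : set {fset G} -> {fset G}) (x : {fset G} -> nat -> G),
    decomposition_property (C0_partial_action R hX s) n ->
    corner_choices n t x ->
    (free_action s <-> full_range (corner_embedding B n t x))).
Proof.
split.
  have [n /(decomposition_finite_domains lcX) fin] := hs; split.
  - exact: orbit_space_hausdorff fin hX.
  - exact: orbit_space_locally_compact fin hX lcX.
  - exists (@descend R _ _ s); split; first exact: descend_iso fin.
    by move=> f ff x; exact: descend_proj fin _ _ ff.
move=> B n t x /(decomposition_finite_domains lcX) fin choices; split.
  by apply: free_full_range.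
by apply: full_range_free.
Qed.
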